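(* Let $A,B,C$ be complex vector spaces of dimension $3$, and let $\overline{\mathit{Tight}}_3$, $\overline{\mathit{Oblique}}_3$, $\overline{\mathit{Free}}_3\subseteq A\otimes B\otimes C$ be the (Zariski, equivalently Euclidean) closures of the sets of concise tight, concise oblique and concise free tensors respectively. Then $A\otimes B\otimes C=\overline{\mathit{Free}}_3$, and $\overline{\mathit{Tight}}_3=\overline{\mathit{Oblique}}_3$, and this last variety has codimension $2$ in $A\otimes B\otimes C$.
   Context: A tensor $T \in A\otimes B\otimes C$ is concise if the three induced linear maps $A^*\to B\otimes C$, $B^*\to A\otimes C$, $C^*\to A\otimes B$ are injective. Write $[m]=\{1,\dots,m\}$. A subset $\mathcal{S}\subseteq[m]\times[m]\times[m]$ is concise if its three projections to $[m]$ are surjective. A concise subset $\mathcal{S}$ is called: - tight if there exist injective functions $\tau_A,\tau_B,\tau_C:[m]\to\mathbb{Z}$ such that $\tau_A(i)+\tau_B(j)+\tau_C(k)=0$ for every $(i,j,k)\in\mathcal{S}$; - oblique if there are total orders on the three copies of $[m]$ such that no two distinct elements of $\mathcal{S}$ are comparable in the induced product partial order on $[m]\times[m]\times[m]$ (i.e. $\mathcal{S}$ is an antichain); - free if any two distinct elements of $\mathcal{S}$ differ in at least two of their three entries. Given bases $\{a_i\},\{b_j\},\{c_k\}$ of $A,B,C$ and $T=\sum T^{ijk}a_i\otimes b_j\otimes c_k$, the support of $T$ in these bases is $\{(i,j,k):T^{ijk}\neq0\}$. A tensor is tight (resp. oblique, free) if there is a choice of bases of $A,B,C$ in which its support is a tight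 (resp. oblique, free) subset. *)

(* Defs.v *)
From HB Require Import structures.
From mathcomp Require Import all_boot all_order all_algebra.
From mathcomp Require Import boolp classical_sets reals complex mpoly.

Set Implicit Arguments.
Unset Strict Implicit.
Unset Printing Implicit Defensive.

Import GRing.Theory.

Local Open Scope ring_scope.
Local Open Scope classical_set_scope.

Notation dual F A := 'Hom(A, F^o).

(* For finite-dimensional spaces, A (x) B (x) C is canonically
   Hom(A^*, Hom(B^*, C)): see [pure] for a (x) b (x) c. *)
Notation tensor F A B C := 'Hom(dual F A, 'Hom(dual F B, C)).

Section Tensors.
Variables (F : fieldType) (A B C : vectType F).

Definition pure (a : A) (b : B) (c : C) : tensor F A B C :=
  linfun (fun f : dual F A =>
    linfun (fun g : dual F B => (f a * g b : F) *: c)).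

(* [linfun] is only meaningful on functions that are linear; this is where
   the linearity in f and g is checked. *)
Lemma pureE a b c (f : dual F A) (g : dual F B) :
  pure a b c f g = (f a * g b : F) *: c.
Proof.
pose inner (f : dual F A) (g : dual F B) := (f a * g b : F) *: c.
have lin_inner f' : linear (inner f').
  by move=> k x y; rewrite /inner add_lfunE scale_lfunE mulrDr scalerDl mulrCA
    scalerA.
pose Li f' := GRing.isLinear.Build _ _ _ _ (inner f') (lin_inner f').
pose inner_lin f' : {linear dual F B -> C} := HB.pack (inner f') (Li f').
have innerE f' g' : linfun (inner f') g' = inner f' g'.
  exact: (lfunE (inner_lin f')).
pose outer (f : dual F A) := linfun (inner f).
have lin_outer : linear outer.
  move=> k x y; apply/lfunP => g'.
  rewrite /outer add_lfunE scale_lfunE !innerE /inner.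
  by rewrite add_lfunE scale_lfunE mulrDl scalerDl -mulrA scalerA.
pose Lo := GRing.isLinear.Build _ _ _ _ outer lin_outer.
pose outer_lin : {linear dual F A -> 'Hom(dual F B, C)} := HB.pack outer Lo.
have -> : pure a b c f = outer f by exact: (lfunE outer_lin).
exact: innerE.
Qed.

(* Injectivity of A^* -> B (x) C, B^* -> A (x) C and C^* -> A (x) B; the image
   of a covector is determined by its values on the two remaining arguments. *)
Definition concise_tensor (T : tensor F A B C) : Prop :=
  [/\ forall f f' : dual F A,
        (forall g : dual F B, T f g = T f' g) -> f = f',
      forall g g' : dual F B,
        (forall f : dual F A, T f g = T f g') -> g = g'
    & forall h h' : dual F C,
        (forall (f : dual F A) (g : dual F B), h (T f g) = h' (T f g)) ->
        h = h'].

End Tensors.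

Section Supports.
Variable m : nat.
Implicit Types S : {set 'I_m * 'I_m * 'I_m}.

Definition concise_set S : Prop :=
  [/\ forall i, exists2 x, x \in S & x.1.1 = i,
      forall j, exists2 x, x \in S & x.1.2 = j
    & forall k, exists2 x, x \in S & x.2 = k].

Definition tight_set S : Prop :=
  concise_set S /\
  exists tauA tauB tauC : 'I_m -> int,
    [/\ injective tauA, injective tauB, injective tauC
      & forall x, x \in S -> tauA x.1.1 + tauB x.1.2 + tauC x.2 = 0].

Definition total_order (r : rel 'I_m) : Prop :=
  [/\ reflexive r, antisymmetric r, transitive r & total r].

Definition oblique_set S : Prop :=
  concise_set S /\
  exists leA leB leC : rel 'I_m,
    [/\ total_order leA, total_order leB, total_order leC
      & forall x y, x \in S -> y \in S ->
          leA x.1.1 y.1.1 -> leB x.1.2 y.1.2 -> leC x.2 y.2 -> x = y].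

Definition free_set S : Prop :=
  concise_set S /\
  forall x y, x \in S -> y \in S -> x != y ->
    (2 <= (x.1.1 != y.1.1) + (x.1.2 != y.1.2) + (x.2 != y.2))%N.

End Supports.

Section SupportOfTensor.
Variables (F : fieldType) (A B C : vectType F) (m : nat).

(* S is the support of T in the given families; when these are bases,
   the coefficients t, hence S, are determined by T. *)
Definition is_support (a : m.-tuple A) (b : m.-tuple B) (c : m.-tuple C)
    (T : tensor F A B C) (S : {set 'I_m * 'I_m * 'I_m}) : Prop :=
  exists t : 'I_m -> 'I_m -> 'I_m -> F,
    T = \sum_i \sum_j \sum_k
          t i j k *: pure (tnth a i) (tnth b j) (tnth c k) /\
    S = finset (fun x => t x.1.1 x.1.2 x.2 != 0).

Definition has_support_in_some_bases
    (P : {set 'I_m * 'I_m * 'I_m} -> Prop) (T : tensor F A B C) : Prop :=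
  exists (a : m.-tuple A) (b : m.-tuple B) (c : m.-tuple C) S,
    [/\ basis_of fullv a, basis_of fullv b & basis_of fullv c] /\
    is_support a b c T S /\ P S.

Definition concise_tight : set (tensor F A B C) :=
  [set T | concise_tensor T /\ has_support_in_some_bases (@tight_set m) T].

Definition concise_oblique : set (tensor F A B C) :=
  [set T | concise_tensor T /\ has_support_in_some_bases (@oblique_set m) T].

Definition concise_free : set (tensor F A B C) :=
  [set T | concise_tensor T /\ has_support_in_some_bases (@free_set m) T].

End SupportOfTensor.

Arguments concise_tight {F} A B C m.
Arguments concise_oblique {F} A B C m.
Arguments concise_free {F} A B C m.

Section Zariski.
Variables (F : fieldType) (V : vectType F).

(* Polynomial functions on V are polynomials in the coordinates with respect
   to one fixed basis; the resulting class does not depend on the basis. *)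
Definition peval (p : {mpoly F[\dim {:V}]}) (v : V) : F :=
  p.@[fun i => coord (vbasis {:V}) i v].

Definition zariski_closed (Z : set V) : Prop :=
  exists I : set {mpoly F[\dim {:V}]},
    Z = [set v | forall p, I p -> peval p v = 0].

Definition zariski_closure (X : set V) : set V :=
  [set v | forall Z, zariski_closed Z -> X `<=` Z -> Z v].

Definition irreducible_closed (Z : set V) : Prop :=
  [/\ zariski_closed Z, Z !=set0
    & forall Z1 Z2, zariski_closed Z1 -> zariski_closed Z2 ->
        Z `<=` Z1 `|` Z2 -> Z `<=` Z1 \/ Z `<=` Z2].

Definition irreducible_chain (X : set V) (n : nat) : Prop :=
  exists Z : nat -> set V,
    (forall i, (i <= n)%N -> irreducible_closed (Z i) /\ Z i `<=` X) /\
    (forall i, (i < n)%N -> Z i `<` Z i.+1).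

(* Krull dimension of a closed subset X. *)
Definition has_dimension (X : set V) (d : nat) : Prop :=
  irreducible_chain X d /\
  forall n, irreducible_chain X n -> (n <= d)%N.

Definition has_codimension (X : set V) (c : nat) : Prop :=
  exists d, has_dimension X d /\ has_dimension [set: V] (d + c).

End Zariski.

(* Main.v *)
(* For m = 3 tight and oblique supports coincide: the support of a tight tensor
   is an antichain for the orders given by the weights, and conversely an
   enumeration of the antichains of [3]^3 finds integer weights for every concise
   one.  An antichain of [3]^3 has at most 7 elements.

   A tensor with support S in some bases is determined by the bases, each vector
   being normalised to have a coordinate equal to 1 (18 parameters), and by |S|
   coefficients.  Tight tensors thus lie in finitely many images of affine
   25-space.  Conversely take S to consist of the (i, i, i) and of the six
   permutations of (0, 1, 2), which is free.  At the unit tensor the differential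
   of the corresponding map from affine 27-space permutes the coordinates, so the
   map is dominant.  Dropping two of the permutations leaves a tight support, and
   the image of that affine 25-space through the unit tensor has dimension 25.

   Krull dimensions are bounded above by transcendence: a strict inclusion
   Z < Z' of irreducible closed sets allows one to extend an algebraically
   independent family on Z by a function vanishing on Z but not on Z'.  They are
   bounded below by the closures of the images of a flag of affine subspaces
   through a point where the Jacobian matrix is invertible. *)

From HB Require Import structures.
From mathcomp Require Import all_boot all_order all_algebra.
From mathcomp Require Import boolp classical_sets reals complex mpoly zify ring.
Require Import Defs.

Set Implicit Arguments.
Unset Strict Implicit.
Unset Printing Implicit Defensive.

Import Order.TTheory GRing.Theory Num.Theory.

Local Open Scope ring_scope.

(** * Derivations and algebraic dependence of polynomials *)

Lemma mpoly_alg_ind (n : nat) (K : comNzRingType) (P : {mpoly K[n]} -> Prop) :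
    (forall c, P c%:MP) -> (forall i, P 'X_i) ->
    (forall p q, P p -> P q -> P (p + q)) ->
    (forall p q, P p -> P q -> P (p * q)) ->
  forall p, P p.
Proof.
move=> PC PX PD PM; elim/mpolyind => [|c m p _ _ Pp].
  by rewrite -mpolyC0.
apply: PD => //; rewrite -mul_mpolyC; apply: (PM) => //.
rewrite mpolyXE_id; apply: (big_ind P) => [|p' q'|]; [by rewrite -mpolyC1|exact: PM|].
move=> i _; elim: (m i) => [|k IHk]; rewrite ?expr0 -?mpolyC1 // exprS.
exact: PM.
Qed.

Lemma mderivXU (n : nat) (K : comNzRingType) (i j : 'I_n) :
  mderiv j 'X_i = (i == j)%:R :> {mpoly K[n]}.
Proof.
rewrite mderivX mnm1E; case: eqP => [->|_]; last by rewrite scale0r.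
rewrite scale1r -[RHS]mpolyX0; congr 'X_[_].
by apply/mnmP => l; rewrite mnmBE mnm0E subnn.
Qed.

(** Both sides are derivations in [p] along [mmap h x], so it suffices to compare them on constants
    and variables. With [D] a partial derivative this is the chain rule for [\mPo]; with [D] the
    derivative of [{poly F}] it differentiates along a line. *)
Lemma mmap_derivation (n : nat) (K S : comNzRingType) (D : {additive S -> S})
    (h : {rmorphism K -> S}) (x : 'I_n -> S) :
    (forall a b, D (a * b) = D a * b + a * D b) -> (forall c, D (h c) = 0) ->
  forall p, D (mmap h x p) = \sum_i mmap h x (mderiv i p) * D (x i).
Proof.
move=> DM Dh; elim/mpoly_alg_ind => [c|i|p q IHp IHq|p q IHp IHq].
- by rewrite mmapC Dh big1 // => i _; rewrite mderivC mmap0 mul0r.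
- rewrite mmapX mmap1U (bigD1 i) //= big1 => [|j ji].
    by rewrite mderivXU eqxx rmorph1 mul1r addr0.
  by rewrite mderivXU eq_sym (negPf ji) mmap0 mul0r.
- rewrite mmapD raddfD /= IHp IHq -big_split /=; apply: eq_bigr => i _.
  by rewrite mderivD mmapD mulrDl.
- rewrite rmorphM DM /= IHp IHq.
  rewrite mulr_suml mulr_sumr -big_split /=; apply: eq_bigr => i _.
  by rewrite mderivM mmapD !rmorphM /= mulrDl mulrAC !mulrA.
Qed.

Lemma mderiv_comp (n k : nat) (K : comNzRingType)
    (q : n.-tuple {mpoly K[k]}) (p : {mpoly K[n]}) j :
  mderiv j (p \mPo q) = \sum_i (mderiv i p \mPo q) * mderiv j (tnth q i).
Proof.
exact: (@mmap_derivation _ _ _ (mderiv j) _ _ (@mderivM _ _ j) (@mderivC _ _ j)).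
Qed.

Section CharacteristicZero.
Variable F : numFieldType.

(** A monomial [m] with [m i != 0] survives in the [i]-th derivative, its coefficient multiplied by
    [m i], which is nonzero in characteristic 0. *)
Lemma mderiv_eq0 n (p : {mpoly F[n]}) :
  (forall i, mderiv i p = 0) -> p = (p@_0%MM)%:MP.
Proof.
move=> dp0; apply/mpolyP => m; rewrite mcoeffC.
have [->|m_neq0] := eqVneq m 0%MM; first by rewrite mulr1.
rewrite mulr0.
have [i mi] : exists i, m i != 0%N.
  apply/existsP; apply: contraR m_neq0; rewrite negb_exists => /forallP m0.
  by apply/eqP/mnmP => i; rewrite mnm0E; apply/eqP; move: (m0 i); rewrite negbK.
have := congr1 (mcoeff (m - U_(i))%MM) (dp0 i).
rewrite mcoeff_deriv mcoeff0 submK; last by rewrite lep1mP.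
by move/eqP; rewrite mulrn_eq0 /= => /eqP.
Qed.

Lemma msize_mderiv_lt n (p : {mpoly F[n]}) i :
  p != 0 -> (msize (mderiv i p) < msize p)%N.
Proof.
move=> p_neq0; have p_gt0 : (0 < msize p)%N by rewrite lt0n msize_poly_eq0.
rewrite -(prednK p_gt0) ltnS msizeE; apply/bigmax_leqP_seq => m + _.
rewrite mcoeff_msupp mcoeff_deriv mulrn_eq0 /= -mcoeff_msupp.
by move=> /msize_mdeg_lt; rewrite mdegD mdeg1 addn1 => lt_mp; rewrite -ltnS (prednK p_gt0).
Qed.

(** On a line parallel to an axis [p] becomes a univariate polynomial with infinitely many roots.
    Hence the partial derivatives vanish everywhere too; by induction on the degree they are zero,
    and [p] is constant. *)
Lemma mpoly_eval_eq0 n (p : {mpoly F[n]}) : (forall v, p.@[v] = 0) -> p = 0.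
Proof.
have [k] := ubnP (msize p); elim: k p => // k IHk p; rewrite ltnS => le_pk p_eval0.
apply/eqP/negP => /negP p_neq0.
have dp0 i : mderiv i p = 0.
  apply: IHk; first exact: leq_trans (msize_mderiv_lt i p_neq0) le_pk.
  move=> v; pose x j : {poly F} := (v j)%:P + ((j == i)%:R *: 'X).
  pose q := mmap (@polyC F) x p.
  have evalq (r : {mpoly F[n]}) t : (mmap (@polyC F) x r).[t] = r.@[fun j => v j + (j == i)%:R * t].
    elim/mpoly_alg_ind: r => [c|j|r s IHr IHs|r s IHr IHs].
    - by rewrite mmapC mevalC hornerC.
    - by rewrite mmapX mmap1U mevalXU /x hornerD hornerC hornerZ hornerX.
    - by rewrite mmapD hornerD IHr IHs mevalD.
    - by rewrite rmorphM hornerM IHr IHs mevalM.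
  have q0 : q = 0.
    apply/eqP/negP => /negP q_neq0.
    (* The naturals below [size q] are distinct in [F]: one root too many for a nonzero [q]. *)
    have := @max_poly_roots _ q [seq t%:R | t <- iota 0 (size q)] q_neq0.
    rewrite size_map size_iota ltnn => q_roots.
    suff: false by []; apply: q_roots.
      by apply/allP => _ /mapP[t _ ->]; rewrite rootE evalq p_eval0.
    by rewrite map_inj_uniq ?iota_uniq //; apply: mulrIn; rewrite oner_eq0.
  have Dx j : deriv (x j) = (j == i)%:R.
    by rewrite derivD derivC derivZ derivX add0r scaler_nat.
  have := @mmap_derivation _ _ _ (@deriv F) (@polyC F) x (@derivM F) (@derivC F) p.
  rewrite -/q q0 raddf0 (bigD1 i) //= Dx eqxx mulr1 big1 ?addr0; last first.
    by move=> j ji; rewrite Dx (negPf ji) mulr0.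
  move/(congr1 (horner^~ 0)); rewrite horner0 evalq => /esym dp0.
  by rewrite -[RHS]dp0; apply: meval_eq => j; rewrite mulr0 addr0.
have := mderiv_eq0 dp0 => pE; move: p_neq0; rewrite pE => /negP; apply.
by have := p_eval0 (fun=> 0); rewrite pE mevalC mcoeffC eqxx mulr1 => ->.
Qed.

(* Jacobian criterion: in a relation of minimal degree, the chain rule makes
   all partial derivatives relations of smaller degree. *)
Lemma jacobian_criterion n (q : n.-tuple {mpoly F[n]}) (x : 'I_n -> F) :
    (forall i j, (mderiv j (tnth q i)).@[x] = (i == j)%:R) ->
  forall p, p \mPo q = 0 -> p = 0.
Proof.
move=> Jx p; have [k] := ubnP (msize p); elim: k p => // k IHk p.
rewrite ltnS => le_pk pq0; apply/eqP/negP => /negP p_neq0.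
pose J := \matrix_(i, j) mderiv j (tnth q i).
have detJ : \det J != 0.
  apply/eqP => /(congr1 (meval x)); rewrite meval0 -det_map_mx.
  have -> : map_mx (meval x) J = 1%:M by apply/matrixP => i j; rewrite !mxE Jx.
  by rewrite det1 => /eqP; rewrite oner_eq0.
pose u := \row_i (mderiv i p \mPo q).
have uJ : u *m J = 0.
  apply/rowP => j; transitivity (\sum_i (mderiv i p \mPo q) * mderiv j (tnth q i)).
    by rewrite mxE; apply: eq_bigr => i _; rewrite !mxE.
  by rewrite -mderiv_comp pq0 mderiv0 mxE.
have u0 i : mderiv i p \mPo q = 0.
  (* [J] need not be invertible over the polynomial ring, but the adjugate gives [\det J * u = 0] in
     an integral domain. *)
  have := congr1 (mulmx^~ (\adj J)) uJ; rewrite -mulmxA mul_mx_adj mul0mx.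
  move/rowP/(_ i); rewrite mul_mx_scalar !mxE => /eqP.
  by rewrite mulf_eq0 (negPf detJ) => /eqP.
have dp0 i : mderiv i p = 0.
  exact: IHk (leq_trans (msize_mderiv_lt i p_neq0) le_pk) (u0 i).
by move: pq0 p_neq0; rewrite (mderiv_eq0 dp0) comp_mpolyC => ->; rewrite eqxx.
Qed.

End CharacteristicZero.

Section AlgebraicDependence.
Variable F : fieldType.

Lemma msizeM_leq m (p q : {mpoly F[m]}) a b :
  (msize p <= a.+1 -> msize q <= b.+1 -> msize (p * q) <= (a + b).+1)%N.
Proof.
move=> pa qb; have [->|p0] := eqVneq p 0; first by rewrite mul0r msize0.
have [->|q0] := eqVneq q 0; first by rewrite mulr0 msize0.
rewrite msizeM // -subn1 leq_subLR (leq_trans (leq_add pa qb)) //.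
by rewrite addSn addnS add1n.
Qed.

Lemma msizeX_leq m (p : {mpoly F[m]}) a k :
  (msize p <= a.+1 -> msize (p ^+ k) <= (k * a).+1)%N.
Proof.
move=> pa; elim: k => [|k IHk]; first by rewrite expr0 msize1.
by rewrite exprS mulSn; apply: msizeM_leq.
Qed.

Lemma leq_bmultinom_exp m b : (#|{: 'X_{1..m < b.+1}}| <= b.+1 ^ m)%N.
Proof.
pose f (x : 'X_{1..m < b.+1}) := [ffun i : 'I_m => inord (x i) : 'I_b.+1].
have f_inj : injective f.
  move=> x y /ffunP fxy; apply/val_inj/mnmP => i.
  have bnd (z : 'X_{1..m < b.+1}) : (z i < b.+1)%N.
    apply: leq_ltn_trans (bmdeg z); rewrite mdegE (bigD1 i) //=; exact: leq_addr.
  by have := congr1 val (fxy i); rewrite !ffunE /= !inordK.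
by have := leq_card f f_inj; rewrite card_ffun !card_ord.
Qed.

(* With exponents bounded by K there are K ^ n monomials in the g i, but they lie
   in a space of dimension O(K ^ m). *)
Lemma algebraically_dependent n m (g : n.-tuple {mpoly F[m]}) :
  (m < n)%N -> exists2 p : {mpoly F[n]}, p != 0 & p \mPo g = 0.
Proof.
move=> lt_mn; pose D := (\max_i msize (tnth g i))%N.
(* [W] bounds the degree of each product [mono e]. Since [W.+1 <= K * (n * D).+1], the monomials of
   degree at most [W] number at most [K ^ m * (n * D).+1 ^ m], less than [K ^ m.+1 <= K ^ n]. *)
pose K := ((n * D).+1 ^ m).+1; pose W := (n * (K * D))%N.
pose E := {ffun 'I_n -> 'I_K}; pose mono (e : E) := \prod_i tnth g i ^+ e i.
have sz_mono e : (msize (mono e) <= W.+1)%N.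
  rewrite /mono /W -[n in (n * _)%N]card_ord -sum_nat_const.
  pose R (p : {mpoly F[m]}) (k : nat) := (msize p <= k.+1)%N.
  apply: (big_ind2 R) => [|p a q b|i _]; rewrite /R.
  - by rewrite msize1.
  - exact: msizeM_leq.
  - have le_D : (msize (tnth g i) <= D)%N by apply: (leq_bigmax (F := fun i => msize (tnth g i))).
    apply: leq_trans (msizeX_leq (e i) (leqW le_D)) _.
    by rewrite ltnS leq_mul2r ltnW ?orbT.
pose A := \matrix_(i < #|E|, j < #|{: 'X_{1..m < W.+1}}|)
  (mono (enum_val i))@_(val (enum_val j)).
have kerA : kermx A != 0.
  rewrite kermx_eq0; apply/negP => /eqP rkA.
  have := rank_leq_col A; rewrite rkA leqNgt => /negP; apply.
  apply: leq_ltn_trans (leq_bmultinom_exp _ _) _.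
  rewrite card_ffun !card_ord.
  apply: (@leq_ltn_trans ((K * (n * D).+1) ^ m)%N).
    have le_W : (W.+1 <= K * (n * D).+1)%N by rewrite /W; nia.
    by case: (posnP m) => [-> //|m_gt0]; rewrite leq_exp2r.
  rewrite expnMn; apply: (@leq_trans (K ^ m.+1)%N); last by rewrite leq_pexp2l.
  by rewrite expnSr ltn_pmul2l // expn_gt0.
have /rowV0Pn[v /sub_kermxP vA v0] := kerA.
pose X (e : E) : 'X_{1..n} := [multinom (e i : nat) | i < n].
have X_inj : injective X.
  move=> e e' /mnmP eX; apply/ffunP => i; apply/val_inj.
  by have := eX i; rewrite !mnmE.
exists (\sum_e v 0 (enum_rank e) *: 'X_[X e]).
  apply: contraNneq v0 => /mpolyP p0; apply/eqP/rowP => i; rewrite mxE.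
  have := p0 (X (enum_val i)); rewrite mcoeff0 raddf_sum (bigD1 (enum_val i)) //=.
  rewrite mcoeffZ mcoeffX eqxx mulr1 enum_valK big1 ?addr0 // => e ne.
  by rewrite mcoeffZ mcoeffX (inj_eq X_inj) (negPf ne) mulr0.
have -> : (\sum_e v 0 (enum_rank e) *: 'X_[X e]) \mPo g = \sum_e v 0 (enum_rank e) *: mono e.
  rewrite raddf_sum; apply: eq_bigr => e _ /=; rewrite comp_mpolyZ comp_mpolyX.
  by congr (_ *: _); apply: eq_bigr => i _; rewrite mnmE.
apply/mpolyP => b; rewrite mcoeff0 raddf_sum /=.
have [lt_bW|le_Wb] := ltnP (mdeg b) W.+1; last first.
  rewrite big1 // => e _; rewrite mcoeffZ memN_msupp_eq0 ?mulr0 //.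
  exact/msize_mdeg_ge/(leq_trans (sz_mono e)).
have /rowP/(_ (enum_rank (BMultinom lt_bW))) := vA; rewrite !mxE => vb.
rewrite (reindex _ (onW_bij _ (@enum_val_bij E))) /= -[RHS]vb.
by apply: eq_bigr => i _; rewrite mcoeffZ !mxE enum_rankK enum_valK.
Qed.

End AlgebraicDependence.

(** * Zariski closures and chains of irreducible sets *)

Section PolynomialMaps.
Local Open Scope classical_set_scope.
Variables (F : numFieldType) (V : vectType F).
Local Notation N := (\dim {:V}).

Lemma zariski_closureP (X : set V) v :
  zariski_closure X v <->
  forall p, (forall x, X x -> peval p x = 0) -> peval p v = 0.
Proof.
split=> [Xv p Xp|Xv _ [I ->] XI p Ip]; last by apply: Xv => x /XI; apply.
apply: (Xv [set v | peval p v = 0]) => //.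
by exists [set p]; apply/seteqP; split=> [x px _ -> //|x]; apply.
Qed.

Lemma zariski_closure_closed (X : set V) : zariski_closed (zariski_closure X).
Proof.
exists [set p | forall x, X x -> peval p x = 0].
by apply/seteqP; split=> x /zariski_closureP.
Qed.

Lemma sub_zariski_closure (X : set V) : X `<=` zariski_closure X.
Proof. by move=> x Xx Z _; apply. Qed.

Lemma zariski_closure_min (X Z : set V) :
  X `<=` zariski_closure Z -> zariski_closure X `<=` zariski_closure Z.
Proof. by move=> XZ x; apply => //; apply: zariski_closure_closed. Qed.

Lemma zeros_closed (p : {mpoly F[N]}) : zariski_closed [set v | peval p v = 0].
Proof. by exists [set p]; apply/seteqP; split=> [x px _ -> //|x]; apply. Qed.

Definition polynomial_map d (phi : ('I_d -> F) -> V) :=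
  exists q : N.-tuple {mpoly F[d]},
    forall p x, peval p (phi x) = (p \mPo q).@[x].

Lemma polynomial_map_comp d e (phi : ('I_d -> F) -> V) (q : d.-tuple {mpoly F[e]}) :
  polynomial_map phi -> polynomial_map (fun y => phi (fun i => (tnth q i).@[y])).
Proof.
move=> [r rE]; exists [tuple tnth r i \mPo q | i < N] => p y.
rewrite rE !comp_mpoly_meval; apply: meval_eq => i.
by rewrite tnth_mktuple comp_mpoly_meval.
Qed.

Lemma polynomial_map_sum d (I : finType) (f : I -> {mpoly F[d]}) (v : I -> V) :
  polynomial_map (fun x => \sum_i (f i).@[x] *: v i).
Proof.
exists [tuple \sum_i coord (vbasis {:V}) j (v i) *: f i | j < N] => p x.
rewrite comp_mpoly_meval; apply: meval_eq => j; rewrite tnth_mktuple !raddf_sum.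
by apply: eq_bigr => i _ /=; rewrite linearZ mevalZ mulrC.
Qed.

(** Functions that vanish on [Z1] and [Z2] respectively, but not on the image, have nonzero
    pullbacks along [phi]. The product of these pullbacks is nonzero, polynomials in [d] variables
    forming an integral domain. *)
Lemma irreducible_closure_range d (phi : ('I_d -> F) -> V) :
  polynomial_map phi -> irreducible_closed (zariski_closure (range phi)).
Proof.
move=> [q qE]; split; first exact: zariski_closure_closed.
  by exists (phi (fun=> 0)); apply: sub_zariski_closure; exists (fun=> 0).
have separate Z : zariski_closed Z -> ~ (zariski_closure (range phi) `<=` Z) ->
    exists2 p, p \mPo q != 0 & forall v, Z v -> peval p v = 0.
  move=> [I ->] /existsNP[z /not_implyP[/zariski_closureP zP]].
  move=> /existsNP[p /not_implyP[Ip pz]]; exists p => [|v]; last exact.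
  by apply: contra_notN pz => /eqP pq0; apply: zP => _ [x _ <-]; rewrite qE pq0 meval0.
move=> Z1 Z2 cl1 cl2 sub12; apply: contrapT => /not_orP[/(separate _ cl1)[p1 p1q Z1p]].
move=> /(separate _ cl2)[p2 p2q Z2p].
have /eqP := mulf_neq0 p1q p2q; apply; apply: mpoly_eval_eq0 => x.
have : zariski_closure (range phi) (phi x) by apply: sub_zariski_closure; exists x.
by rewrite mevalM -!qE => /sub12[/Z1p ->|/Z2p ->]; rewrite ?mul0r ?mulr0.
Qed.

Lemma meval_muni n (p : {mpoly F[n.+1]}) (x : 'I_n.+1 -> F) :
  p.@[x] = (map_poly (meval (fun i => x (widen_ord (leqnSn n) i))) (muni p)).[x ord_max].
Proof.
rewrite muniE mevalE raddf_sum horner_sum; apply: eq_bigr => m _ /=.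
rewrite map_polyZ /= map_polyXn hornerZ hornerXn mevalZ mevalX.
rewrite big_ord_recr /= mulrA; congr (_ * _ * _).
by apply: eq_bigr => i _; rewrite mnmE; congr (x _ ^+ m _); apply: val_inj.
Qed.

(** Algebraic independence over [F] of the functions induced on [X] by the [g i]. *)
Definition independent_on (X : set V) n (g : 'I_n -> {mpoly F[N]}) :=
  forall p : {mpoly F[n]},
    (forall v, X v -> p.@[fun i => peval (g i) v] = 0) -> p = 0.

(* Let f vanish on Z but not on Z', and let P = P0(g) + f Q(g, f) vanish on Z'.
   Restricting to Z gives P0 = 0; as Z' is irreducible, Q(g, f) vanishes on Z',
   and one concludes by induction on the degree in f. *)
Lemma independent_on_extend (Z Z' : set V) n (g : 'I_n -> {mpoly F[N]}) :
    irreducible_closed Z -> irreducible_closed Z' -> Z `<` Z' ->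
  independent_on Z g ->
  exists g' : 'I_n.+1 -> {mpoly F[N]}, independent_on Z' g'.
Proof.
move=> [[I ZE] _ _] [_ _ irrZ'] [subZ nsubZ] indep.
have [f Zf Z'f] : exists2 f, forall v, Z v -> peval f v = 0 &
    ~ (forall v, Z' v -> peval f v = 0).
  apply: contrapT => /forall2NP noP; apply: nsubZ => v Z'v; rewrite ZE => p Ip.
  case: (noP p) => [|/contrapT]; last exact.
  by case=> u; rewrite ZE; apply.
(* The new function takes the last place, the variable that [muni] singles out. *)
exists (fun i => oapp g f (unlift ord_max i)) => p p0.
have key (Q : {poly {mpoly F[n]}}) : (forall v, Z' v ->
    (map_poly (meval (fun i => peval (g i) v)) Q).[peval f v] = 0) -> Q = 0.
  elim/poly_ind: Q => [//|Q c IHQ] Qc0.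
  have c0 : c = 0.
    apply: indep => v Zv; have := Qc0 v (subZ v Zv).
    rewrite rmorphD rmorphM /= map_polyX map_polyC hornerD hornerMX hornerC.
    by rewrite Zf // mulr0 add0r.
  rewrite c0 addr0 IHQ ?mul0r // => v Z'v.
  (* [h] is $Q(g, f)$ as a polynomial function on [V], so its zero set is closed and irreducibility
     of [Z'] applies to the product of [f] and [h]. *)
  pose h := (map_poly (comp_mpoly [tuple g i | i < n]) Q).[f].
  have hE u : peval h u = (map_poly (meval (fun i => peval (g i) u)) Q).[peval f u].
    rewrite /h /peval -horner_map -map_poly_comp; congr (_.[_]).
    apply: eq_map_poly => r /=; rewrite comp_mpoly_meval.
    by apply: meval_eq => i; rewrite tnth_mktuple.
  have sub12 : Z' `<=` [set u | peval f u = 0] `|` [set u | peval h u = 0].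
    move=> u Z'u; have /eqP := Qc0 u Z'u.
    rewrite c0 addr0 rmorphM /= map_polyX hornerMX mulf_eq0 -hE.
    by case/orP => /eqP ?; [right|left].
  by case: (irrZ' _ _ (zeros_closed f) (zeros_closed h) sub12) => [//|/(_ v Z'v)]; rewrite -hE.
suff p_eq0 : muni p = 0.
  by apply: mpoly_eval_eq0 => x; rewrite meval_muni p_eq0 raddf0 horner0.
apply: key => v Z'v; rewrite -[RHS](p0 v Z'v) meval_muni unlift_none /=; congr (_.[_]).
apply: eq_map_poly => r; apply: meval_eq => i.
have -> : widen_ord (leqnSn n) i = lift ord_max i.
  by apply: val_inj; rewrite /= /bump leqNgt ltn_ord.
by rewrite liftK.
Qed.

Lemma chain_independent (Z : nat -> set V) n :
    (forall i, (i <= n)%N -> irreducible_closed (Z i)) ->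
    (forall i, (i < n)%N -> Z i `<` Z i.+1) ->
  exists g : 'I_n -> {mpoly F[N]}, independent_on (Z n) g.
Proof.
elim: n => [|n IHn] irrZ ltZ.
  exists (fun=> 0) => p p0; have [_ [v Zv] _] := irrZ 0%N isT.
  apply: mpoly_eval_eq0 => x; rewrite -[RHS](p0 v Zv).
  by apply: meval_eq => -[].
have [i le_in|i lt_in|g g_indep] := IHn.
- exact/irrZ/leqW.
- exact/ltZ/leqW.
- exact: independent_on_extend (irrZ n _) (irrZ n.+1 _) (ltZ n _) g_indep.
Qed.

(** A chain of length [n > d] yields [n] independent functions on its top member. On each of the
    finitely many images these satisfy a nontrivial relation, being polynomials in [d] variables;
    the product of the relations vanishes on the union of the images, hence on its closure. *)
Lemma irreducible_chain_le (L : finType) d (phi : L -> ('I_d -> F) -> V) X n :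
    (forall l, polynomial_map (phi l)) ->
    X `<=` zariski_closure [set v | exists l x, v = phi l x] ->
  irreducible_chain X n -> (n <= d)%N.
Proof.
move=> poly_phi subX [Z [irrZ ltZ]]; rewrite leqNgt; apply/negP => lt_dn.
have [g g_indep] := chain_independent (fun i le_in => (irrZ i le_in).1) ltZ.
have relation l : exists p : {mpoly F[n]}, p != 0 /\
    forall x, p.@[fun i => peval (g i) (phi l x)] = 0.
  have [q qE] := poly_phi l.
  have [p p_neq0 p0] := algebraically_dependent [tuple g i \mPo q | i < n] lt_dn.
  exists p; split=> // x; have := congr1 (meval x) p0; rewrite meval0 comp_mpoly_meval => <-.
  by apply: meval_eq => i; rewrite tnth_mktuple qE.
have [p pP] := choice relation.
have /eqP : \prod_l p l != 0 by apply/prodf_neq0 => l _; case: (pP l).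
apply; apply: g_indep => v /((irrZ n (leqnn n)).2) /subX /zariski_closureP.
move=> /(_ ((\prod_l p l) \mPo [tuple g i | i < n])).
rewrite /peval comp_mpoly_meval => vP.
rewrite -[RHS]vP => [|_ [l [x ->]]]; first by apply: meval_eq => i; rewrite tnth_mktuple.
rewrite comp_mpoly_meval rmorph_prod (bigD1 l) //=.
have [_ /(_ x)] := pP l; rewrite -[X in X * _ = _]/(_.@[_]).
set a := meval _ _ => a0; set b := meval _ _.
have -> : b = a by apply: meval_eq => i; rewrite tnth_mktuple.
by rewrite a0 mul0r.
Qed.

(** * Flags of affine slices through a point with invertible Jacobian matrix *)

Section Slices.
Variables (d : nat) (x0 : 'I_d -> F).

Definition slice_poly k : d.-tuple {mpoly F[k]} :=
  [tuple oapp (fun j => 'X_j) (x0 i)%:MP (insub (i : nat)) | i < d].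

(* The affine subspace of dimension k through x0 whose last coordinates are those
   of x0. *)
Definition slice k (y : 'I_k -> F) (i : 'I_d) : F :=
  oapp y (x0 i) (insub (i : nat)).

Lemma slice_polyE k (y : 'I_k -> F) :
  slice y = fun i => (tnth (slice_poly k) i).@[y].
Proof.
apply/funext => i; rewrite tnth_mktuple /slice.
by case: insub => [j|] /=; rewrite ?mevalXU ?mevalC.
Qed.

Lemma slice_base k (le_kd : (k <= d)%N) :
  slice (fun j => x0 (widen_ord le_kd j)) = x0.
Proof.
apply/funext => i; rewrite /slice; case: insubP => //= j _ ji.
by congr x0; apply: val_inj.
Qed.

Lemma slice_succ k (lt_kd : (k < d)%N) (y : 'I_k -> F) :
  slice (fun j : 'I_k.+1 => slice y (widen_ord lt_kd j)) = slice y.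
Proof.
apply/funext => i; rewrite {1}/slice; case: insubP => [j _ ji|] /=.
  by congr (slice y); apply: val_inj.
by rewrite -leqNgt /slice => lt_ki; rewrite insubN // -leqNgt ltnW.
Qed.

Variables (phi : ('I_d -> F) -> V) (lam : 'I_d -> {mpoly F[N]}).
Variable psi : d.-tuple {mpoly F[d]}.
Hypothesis phi_poly : polynomial_map phi.
Hypothesis psiE : forall x i, peval (lam i) (phi x) = (tnth psi i).@[x].
Hypothesis Jpsi : forall i j, (mderiv j (tnth psi i)).@[x0] = (i == j)%:R.

Lemma slice_map_poly k : polynomial_map (fun y : 'I_k -> F => phi (slice y)).
Proof.
have -> : (fun y : 'I_k -> F => phi (slice y)) =
    fun y => phi (fun i => (tnth (slice_poly k) i).@[y]).
  by apply/funext => y; rewrite slice_polyE.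
exact: polynomial_map_comp.
Qed.

(** By the chain rule, the Jacobian matrix at [x0] of the first [k] functions on the slice is the
    leading block of the identity matrix. *)
Lemma slice_independent k (le_kd : (k <= d)%N) :
  independent_on (range (fun y : 'I_k -> F => phi (slice y)))
    (fun i : 'I_k => lam (widen_ord le_kd i)).
Proof.
move=> p p0.
pose q := [tuple tnth psi (widen_ord le_kd i) \mPo slice_poly k | i < k].
apply: (@jacobian_criterion _ _ q (fun j => x0 (widen_ord le_kd j))).
  move=> i j; rewrite tnth_mktuple mderiv_comp raddf_sum /=.
  rewrite (bigD1 (widen_ord le_kd i)) //= big1 => [|l ne_li].
    rewrite addr0 mevalM comp_mpoly_meval -slice_polyE slice_base Jpsi eqxx mul1r.
    rewrite tnth_mktuple insubT /= => [|lt_ik]; first exact: ltn_ord.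
    rewrite mderivXU rmorph_nat; congr (_ == _)%:R; exact: val_inj.
  by rewrite mevalM comp_mpoly_meval -slice_polyE slice_base Jpsi eq_sym (negPf ne_li) mul0r.
apply: mpoly_eval_eq0 => y; rewrite comp_mpoly_meval -[RHS](p0 (phi (slice y))); last by exists y.
by apply: meval_eq => i; rewrite tnth_mktuple comp_mpoly_meval psiE slice_polyE.
Qed.

Lemma jacobian_chain n : (n <= d)%N ->
  irreducible_chain (zariski_closure (range (fun y : 'I_n -> F => phi (slice y)))) n.
Proof.
move=> le_nd; pose Y k := range (fun y : 'I_k -> F => phi (slice y)).
have subY k (lt_kd : (k < d)%N) : Y k `<=` Y k.+1.
  move=> _ [y _ <-]; exists (fun j => slice y (widen_ord lt_kd j)) => //.
  by rewrite slice_succ.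
have subYn k : (k <= n)%N -> Y k `<=` Y n.
  elim: n le_nd => [|m IHm] le_md; first by rewrite leqn0 => /eqP ->.
  rewrite leq_eqVlt => /predU1P[-> //|lt_km].
  exact: subset_trans (IHm (ltnW le_md) lt_km) (subY m le_md).
exists (fun k => zariski_closure (Y k)); split=> k lt_kn.
  split; first exact/irreducible_closure_range/slice_map_poly.
  by apply: zariski_closure_min => x /(subYn k lt_kn); apply: sub_zariski_closure.
have lt_kd := leq_trans lt_kn le_nd.
split; first by apply: zariski_closure_min => x /(subY k lt_kd); apply: sub_zariski_closure.
move=> sub.
have [q qE] := slice_map_poly k.
(* Strictness: the first [k.+1] functions [lam] are dependent on the image of the [k]-dimensional
   slice. Were the closures equal, the relation would hold on the next image, where they are
   independent. *)
have [p p_neq0 p0] := algebraically_dependent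
  [tuple lam (widen_ord lt_kd i) \mPo q | i < k.+1] (ltnSn k).
move/eqP: p_neq0; apply; apply: (slice_independent (le_kd := lt_kd)) => v Yv.
have /sub/zariski_closureP : zariski_closure (Y k.+1) v by apply: sub_zariski_closure.
move=> /(_ (p \mPo [tuple lam (widen_ord lt_kd i) | i < k.+1])).
rewrite /peval comp_mpoly_meval => vP.
rewrite -[RHS]vP => [|_ [y _ <-]]; first by apply: meval_eq => i; rewrite tnth_mktuple.
have := congr1 (meval y) p0; rewrite meval0 !comp_mpoly_meval => <-.
by apply: meval_eq => i; rewrite !tnth_mktuple -qE.
Qed.

End Slices.
End PolynomialMaps.

(** * Tight and oblique supports *)

Section Supports.
Variable m : nat.
Implicit Types S : {set 'I_m * 'I_m * 'I_m}.

Lemma tight_oblique_set S : tight_set S -> oblique_set S.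
Proof.
case=> conS [tA [tB [tC [injA injB injC tS]]]]; split=> //.
have ord (t : 'I_m -> int) : injective t -> total_order (fun i j => t i <= t j)%R.
  move=> t_inj; split=> [i|i j /le_anti/t_inj //|j i k|i j]; [exact: lexx|exact: le_trans|].
  exact: le_total.
exists (fun i j => tA i <= tA j)%R, (fun i j => tB i <= tB j)%R, (fun i j => tC i <= tC j)%R.
split; [exact: ord..|move=> [[i j] k] [[i' j'] k'] xS yS /= leA leB leC].
have /= tx := tS _ xS; have /= ty := tS _ yS.
have eA : tA i = tA i' by lia.
have eB : tB j = tB j' by lia.
have eC : tC k = tC k' by lia.
by rewrite (injA _ _ eA) (injB _ _ eB) (injC _ _ eC).
Qed.

(** The rank of [i] is the number of elements below [i], itself included, minus one. Ranks reduce
    arbitrary total orders to the usual order of the integers, so that a single enumeration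
    suffices. *)
Lemma total_order_rank (r : rel 'I_m) : total_order r ->
  exists2 p : 'I_m -> 'I_m, injective p & forall i j, (p i <= p j)%N -> r i j.
Proof.
case=> rr ra rt rtot; pose down i := [set j | r j i].
have down_gt0 i : (0 < #|down i|)%N by apply/card_gt0P; exists i; rewrite inE.
have lt_down i : (#|down i|.-1 < m)%N.
  by rewrite (prednK (down_gt0 i)) -[m in (_ <= m)%N]card_ord max_card.
pose p i := Ordinal (lt_down i).
have p_le i j : (p i <= p j)%N -> r i j.
  move=> /= le_ij; have {}le_ij : (#|down i| <= #|down j|)%N.
    by rewrite -(prednK (down_gt0 i)) -(prednK (down_gt0 j)).
  have /orP[//|rji] := rtot i j; have : down j \subset down i.
    by apply/fintype.subsetP => k; rewrite !inE => /rt; apply.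
  rewrite subEproper => /predU1P[/setP/(_ i)|/proper_card].
    by rewrite !inE rr => ->.
  by rewrite ltnNge le_ij.
by exists p => // i j eq_ij; apply: ra; rewrite !p_le ?eq_ij.
Qed.

End Supports.

(** * Enumeration of the antichains of $\{0,1,2\}^3$ *)

Section Antichains.
Local Open Scope nat_scope.
Local Notation point := (nat * nat * nat)%type.

Definition le3 (x y : point) := [&& x.1.1 <= y.1.1, x.1.2 <= y.1.2 & x.2 <= y.2].

(* The conditional is lazy under [vm_compute], unlike [==>]; this prunes the
   enumeration. *)
Fixpoint all_antichains (ok : pred (seq point)) acc rest :=
  if rest is x :: rest' then
    (if all (fun y => ~~ le3 x y && ~~ le3 y x) acc
     then all_antichains ok (x :: acc) rest' else true)
    && all_antichains ok acc rest'
  else ok acc.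

(** The branch that keeps exactly the points satisfying [P] is never pruned: uniqueness makes a kept
    point differ from the next one, so comparability would contradict the antichain property. *)
Lemma all_antichainsP ok (P : pred point) acc rest :
    (forall x y, P x -> P y -> le3 x y -> x = y) -> uniq (catrev acc rest) ->
    all P acc -> all_antichains ok acc rest ->
  ok (catrev (filter P rest) acc).
Proof.
move=> antiP; elim: rest acc => //= x rest IHrest acc uniq_acc Pacc /andP[okx ok_acc].
have uniq_rest : uniq (catrev acc rest).
  by move: uniq_acc; rewrite !catrevE !cat_uniq /= negb_or => /and3P[-> /andP[_ ->] /andP[_ ->]].
case Px: (P x); last exact: IHrest.
apply: (IHrest (x :: acc)); rewrite //= ?Px //.
move: okx; rewrite ifT //; apply/allP => y y_acc.
have yx : y != x.
  apply: contraTneq uniq_acc => yx; rewrite catrevE cat_uniq /= -yx mem_rev y_acc /=.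
  by rewrite andbF.
have Py := allP Pacc y y_acc.
by apply/andP; split; apply: contraNN yx => /antiP ->.
Qed.

Definition points3 : seq point :=
  [seq (ij, k) | ij <- [seq (i, j) | i <- iota 0 3, j <- iota 0 3], k <- iota 0 3].

Definition concise3 (s : seq point) :=
  all (fun i => [&& has (fun x => x.1.1 == i) s, has (fun x => x.1.2 == i) s
                  & has (fun x => x.2 == i) s]) (iota 0 3).

(** The increasing triples that start at 0 and have entries at most 4. Starting at 0 is a
    normalisation, because [tight3] only asks for a constant sum; [antichains3] checks that the
    bound 4 is large enough. *)
Definition weights3 : seq (seq nat) := [:: [:: 0; 1; 2]; [:: 0; 1; 3]; [:: 0; 1; 4];
  [:: 0; 2; 3]; [:: 0; 2; 4]; [:: 0; 3; 4]].

Definition tight3 (s : seq point) :=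
  has (fun a => has (fun b => has (fun c =>
    constant [seq nth 0 a x.1.1 + nth 0 b x.1.2 + nth 0 c x.2 | x <- s])
    weights3) weights3) weights3.

Lemma antichains3 :
  all_antichains (fun s => (size s <= 7) && (if concise3 s then tight3 s else true)) [::] points3.
Proof. by vm_compute. Qed.

End Antichains.

(** The ranks carry [S] to an antichain for the usual orders, to which the enumeration applies; the
    weights found there are composed with the ranks. *)
Lemma oblique_set3 (S : {set 'I_3 * 'I_3 * 'I_3}) :
  oblique_set S -> (#|S| <= 7)%N /\ tight_set S.
Proof.
case=> conS [lA [lB [lC [oA oB oC antiS]]]].
have [pA injA leA] := total_order_rank oA.
have [pB injB leB] := total_order_rank oB.
have [pC injC leC] := total_order_rank oC.
pose f (x : 'I_3 * 'I_3 * 'I_3) : nat * nat * nat :=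
  ((pA x.1.1 : nat, pB x.1.2 : nat), pC x.2 : nat).
have f_inj : injective f.
  by move=> [[i j] k] [[i' j'] k'] [/val_inj/injA -> /val_inj/injB -> /val_inj/injC ->].
pose P y := y \in [seq f x | x <- enum S].
have PP y : reflect (exists2 x, x \in S & y = f x) (P y).
  by apply: (iffP mapP) => -[x]; rewrite ?mem_enum => xS ->; exists x; rewrite ?mem_enum.
have antiP x y : P x -> P y -> le3 x y -> x = y.
  move=> /PP[x' x'S ->] /PP[y' y'S ->] /and3P[/= /leA leA' /leB leB' /leC leC'].
  by rewrite (antiS x' y').
have P3 y : P y -> y \in points3.
  case/PP => [[[i j] k]] _ ->.
  by apply: (allpairs_f pair); first apply: (allpairs_f pair); rewrite mem_iota ltn_ord.
have := @all_antichainsP _ P [::] points3 antiP isT isT antichains3.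
set s := catrev _ _; have sP y : (y \in s) = P y.
  rewrite /s catrevE cats0 mem_rev mem_filter.
  by case Py: (P y) => //=; apply: P3.
case/andP => size_s tight_s; split.
  apply: leq_trans size_s; rewrite cardE -(size_map f); apply: uniq_leq_size.
    by rewrite map_inj_uniq ?enum_uniq.
  by move=> y yS; rewrite sP.
have concise_s : concise3 s.
  case: conS => cA cB cC; apply/allP => i; rewrite mem_iota add0n => /= lt_i3.
  have [qA _ qAK] := injF_bij injA; have [qB _ qBK] := injF_bij injB.
  have [qC _ qCK] := injF_bij injC.
  apply/and3P; split; apply/hasP.
  - have [x xS xi] := cA (qA (Ordinal lt_i3)); exists (f x).
      by rewrite sP; apply/PP; exists x.
    by rewrite /= xi qAK.
  - have [x xS xi] := cB (qB (Ordinal lt_i3)); exists (f x).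
      by rewrite sP; apply/PP; exists x.
    by rewrite /= xi qBK.
  - have [x xS xi] := cC (qC (Ordinal lt_i3)); exists (f x).
      by rewrite sP; apply/PP; exists x.
    by rewrite /= xi qCK.
split=> //; move: tight_s; rewrite concise_s.
move=> /hasP[a aW /hasP[b bW /hasP[c cW /(constantP 0%N)[n sE]]]].
have w_inj w (p : 'I_3 -> 'I_3) : w \in weights3 -> injective p ->
    injective (fun i => (nth 0%N w (p i))%:Z).
  move=> wW p_inj i j [eq_ij]; apply/p_inj/val_inj/eqP.
  have /andP[/eqP sw uw] : (size w == 3%N) && uniq w.
    by move: w wW {eq_ij}; apply/allP.
  by rewrite -(nth_uniq 0%N _ _ uw) ?sw ?ltn_ord // eq_ij.
(* The common value [n] of the sums is subtracted from the third weights to make the sums 0. *)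
exists (fun i => (nth 0%N a (pA i))%:Z), (fun i => (nth 0%N b (pB i))%:Z),
  (fun i => (nth 0%N c (pC i))%:Z - n%:Z); split.
- exact: w_inj.
- exact: w_inj.
- by move=> i j /addIr; apply: (w_inj c pC).
move=> x xS; have : f x \in s by rewrite sP; apply/PP; exists x.
move=> /(map_f (fun x => nth 0 a x.1.1 + nth 0 b x.1.2 + nth 0 c x.2)%N).
rewrite sE mem_nseq => /andP[_ /eqP /= fx]; lia.
Qed.

(* Without a name for this space, unification keeps unfolding the module
   structures of the nested 'Hom. *)
Definition tensor_space (F : fieldType) (A B C : vectType F) : vectType F :=
  tensor F A B C.

(** * Coordinates of tensors *)

Section TensorCoordinates.
Variables (F : fieldType) (A B C : vectType F) (m : nat).
Variables (a : m.-tuple A) (b : m.-tuple B) (c : m.-tuple C).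
Hypotheses (aP : basis_of fullv a) (bP : basis_of fullv b) (cP : basis_of fullv c).
Local Notation point := ('I_m * 'I_m * 'I_m)%type.

Definition dual_vector (W : vectType F) (w : m.-tuple W) i : dual F W :=
  linfun (coord w i : W -> F^o).

Lemma dual_vectorE (W : vectType F) (w : m.-tuple W) i v : dual_vector w i v = coord w i v.
Proof. by rewrite lfunE. Qed.

Lemma coord_tnth (W : vectType F) (w : m.-tuple W) i j : basis_of fullv w ->
  coord w i (tnth w j) = (i == j)%:R.
Proof. by move=> wP; rewrite (tnth_nth 0) coord_free ?(basis_free wP) // eq_sym. Qed.

Lemma coord_expand (W : vectType F) (w : m.-tuple W) v : basis_of fullv w ->
  v = \sum_i coord w i v *: tnth w i.
Proof.
move=> wP; rewrite {1}(coord_basis wP (memvf v)).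
by apply: eq_bigr => i _; rewrite (tnth_nth 0).
Qed.

Lemma dual_expand (W : vectType F) (w : m.-tuple W) (f : dual F W) : basis_of fullv w ->
  f = \sum_i (f (tnth w i) : F) *: dual_vector w i.
Proof.
move=> wP; apply/lfunP => v; rewrite {1}(coord_expand v wP) sum_lfunE linear_sum.
by apply: eq_bigr => i _; rewrite linearZ scale_lfunE dual_vectorE; apply: mulrC.
Qed.

Definition basis_tensor (x : point) : tensor_space A B C :=
  pure (tnth a x.1.1) (tnth b x.1.2) (tnth c x.2).

Definition tensor_coord (x : point) (T : tensor_space A B C) : F :=
  coord c x.2 (T (dual_vector a x.1.1) (dual_vector b x.1.2)).

Lemma tensor_coord_is_linear x : linear_for *%R (tensor_coord x).
Proof. by move=> k T U; rewrite /tensor_coord !(add_lfunE, scale_lfunE) linearP. Qed.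

HB.instance Definition _ x :=
  GRing.isLinear.Build F (tensor_space A B C) F *%R (tensor_coord x) (tensor_coord_is_linear x).

Lemma tensor_coord_basis x y : tensor_coord x (basis_tensor y) = (x == y)%:R.
Proof.
rewrite /tensor_coord /basis_tensor pureE linearZ /= !dual_vectorE !coord_tnth //.
by case: x y => [[i j] k] [[i' j'] k']; rewrite -!natrM !mulnb /eq_op /=.
Qed.

Lemma tensor_coord_sum x (t : point -> F) :
  tensor_coord x (\sum_y t y *: basis_tensor y) = t x.
Proof.
rewrite linear_sum (bigD1 x) //= linearZ /= tensor_coord_basis eqxx mulr1.
rewrite big1 ?addr0 // => y yx.
by rewrite linearZ /= tensor_coord_basis eq_sym (negPf yx) mulr0.
Qed.

Lemma sum_pointE (U : nmodType) (G : point -> U) :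
  \sum_i \sum_j \sum_k G (i, j, k) = \sum_x G x.
Proof. by rewrite pair_bigA /= pair_bigA /=; apply: eq_bigr => -[[i j] k]. Qed.

Lemma tensor_eval (T : tensor F A B C) f g : T f g =
  \sum_x (tensor_coord x T * (f (tnth a x.1.1) * g (tnth b x.1.2))) *: tnth c x.2.
Proof.
rewrite -(sum_pointE (fun x => (tensor_coord x T *
  (f (tnth a x.1.1) * g (tnth b x.1.2))) *: tnth c x.2)) /=.
rewrite {1}(dual_expand f aP) linear_sum sum_lfunE; apply: eq_bigr => i _.
rewrite linearZ scale_lfunE {1}(dual_expand g bP) linear_sum scaler_sumr.
apply: eq_bigr => j _; rewrite linearZ /= scalerA.
rewrite {1}(coord_expand (T _ _) cP) scaler_sumr; apply: eq_bigr => k _.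
by rewrite scalerA mulrC.
Qed.

Lemma tensor_expand (T : tensor_space A B C) :
  T = \sum_x tensor_coord x T *: basis_tensor x.
Proof.
apply/lfunP => f; apply/lfunP => g; rewrite tensor_eval !sum_lfunE.
by apply: eq_bigr => x _; rewrite !scale_lfunE pureE scalerA.
Qed.

(** The coefficients in [is_support] are forced: they are the values of [T] on the dual bases. *)
Lemma is_supportP (T : tensor F A B C) S :
  is_support a b c T S <-> S = [set x | tensor_coord x T != 0].
Proof.
have evalE (t : 'I_m -> 'I_m -> 'I_m -> F) f g :
    (\sum_i \sum_j \sum_k t i j k *: pure (tnth a i) (tnth b j) (tnth c k)) f g =
    \sum_x (t x.1.1 x.1.2 x.2 * (f (tnth a x.1.1) * g (tnth b x.1.2))) *: tnth c x.2.
  rewrite -(sum_pointE (fun x => (t x.1.1 x.1.2 x.2 *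
    (f (tnth a x.1.1) * g (tnth b x.1.2))) *: tnth c x.2)) !sum_lfunE.
  apply: eq_bigr => i _; rewrite !sum_lfunE; apply: eq_bigr => j _; rewrite !sum_lfunE.
  by apply: eq_bigr => k _; rewrite !scale_lfunE pureE scalerA.
split=> [[t [TE ->]]|->].
  apply/setP => x; rewrite !inE; congr (_ != 0).
  rewrite /tensor_coord TE evalE linear_sum (bigD1 x) //=.
  rewrite linearZ /= !dual_vectorE !coord_tnth // !eqxx !mulr1 big1 ?addr0 // => y yx.
  rewrite linearZ /= !dual_vectorE !coord_tnth // -mulrA -!natrM !mulnb.
  by rewrite -[X in X%:R]/(x == y : nat) eq_sym (negPf yx) mulr0.
exists (fun i j k => tensor_coord (i, j, k) T); split.
  by apply/lfunP => f; apply/lfunP => g; rewrite evalE tensor_eval.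
by apply/setP => -[[i j] k]; rewrite !inE.
Qed.

Lemma tensor_coord_pure x u v w :
  tensor_coord x (pure u v w) = coord a x.1.1 u * coord b x.1.2 v * coord c x.2 w.
Proof. by rewrite /tensor_coord pureE linearZ /= !dual_vectorE. Qed.

(* In a free support distinct slices are disjoint, so the rows of each flattening
   are linearly independent as soon as they are nonzero. *)
Lemma concise_free_support (T : tensor_space A B C) S :
  is_support a b c T S -> free_set S -> concise_tensor T.
Proof.
move=> /is_supportP SE [[conA conB conC] freeS]; pose t x := tensor_coord x T.
have t_neq0 x : (x \in S) = (t x != 0) by rewrite SE inE.
have t_line x y : x \in S -> x != y ->
    ((x.1.1 != y.1.1) + (x.1.2 != y.1.2) + (x.2 != y.2) <= 1)%N -> t y = 0.
  move=> xS xy le1; apply/eqP; rewrite -[_ == _]negbK -t_neq0; apply/negP => yS.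
  by have := freeS x y xS yS xy; rewrite leqNgt ltnS le1.
split=> [f f' ff'|g g' gg'|h h' hh'].
- apply/eqP; rewrite -subr_eq0 (dual_expand (f - f') aP).
  apply/eqP/big1 => i _; have [x xS <-] := conA i.
  (* Pairing [T (f - f')] with the dual vectors of the last two entries of [x] leaves only the term
     of [x]: other points with these two entries lie outside [S]. *)
  have : (f - f') (tnth a x.1.1) * t x = 0.
    have Tf0 : T (f - f') (dual_vector b x.1.2) = 0.
      by rewrite linearB add_lfunE opp_lfunE ff' subrr.
    rewrite -[RHS](linear0 (coord c x.2)) -Tf0.
    rewrite [in RHS](dual_expand (f - f') aP) linear_sum sum_lfunE linear_sum.
    rewrite (bigD1 x.1.1) //= linearZ scale_lfunE linearZ /=.
    rewrite -/(tensor_coord (x.1.1, x.1.2, x.2) T) -/(t (x.1.1, x.1.2, x.2))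
      -!surjective_pairing.
    rewrite big1 ?addr0 // => j ji.
    rewrite linearZ scale_lfunE linearZ /=
      -/(tensor_coord (j, x.1.2, x.2) T) -/(t (j, x.1.2, x.2)).
    rewrite (t_line x) ?mulr0 //= ?eqxx ?addn0 ?leq_b1 //.
    by apply: contraNneq ji => ->.
  by move/eqP; rewrite mulf_eq0 -[t x == 0]negbK -t_neq0 xS orbF => /eqP ->; rewrite scale0r.
- apply/eqP; rewrite -subr_eq0 (dual_expand (g - g') bP).
  apply/eqP/big1 => i _; have [x xS <-] := conB i.
  have : (g - g') (tnth b x.1.2) * t x = 0.
    have Tg0 : T (dual_vector a x.1.1) (g - g') = 0 by rewrite linearB /= gg' subrr.
    rewrite -[RHS](linear0 (coord c x.2)) -Tg0.
    rewrite [in RHS](dual_expand (g - g') bP) !linear_sum.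
    rewrite (bigD1 x.1.2) //= !linearZ /=.
    rewrite -/(tensor_coord (x.1.1, x.1.2, x.2) T) -/(t (x.1.1, x.1.2, x.2))
      -!surjective_pairing.
    rewrite big1 ?addr0 // => j ji.
    rewrite !linearZ /= -/(tensor_coord (x.1.1, j, x.2) T) -/(t (x.1.1, j, x.2)).
    rewrite (t_line x) ?mulr0 //= ?eqxx ?addn0 ?leq_b1 //.
    by apply: contraNneq ji => ->.
  by move/eqP; rewrite mulf_eq0 -[t x == 0]negbK -t_neq0 xS orbF => /eqP ->; rewrite scale0r.
- apply/eqP; rewrite -subr_eq0 (dual_expand (h - h') cP).
  apply/eqP/big1 => i _; have [x xS <-] := conC i.
  have : (h - h') (tnth c x.2) * t x = 0.
    have Th0 : (h - h') (T (dual_vector a x.1.1) (dual_vector b x.1.2)) = 0.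
      by rewrite add_lfunE opp_lfunE hh' subrr.
    rewrite -[RHS]Th0.
    rewrite (coord_expand (T _ _) cP) linear_sum (bigD1 x.2) //= linearZ /=.
    rewrite -/(tensor_coord (x.1.1, x.1.2, x.2) T) -/(t (x.1.1, x.1.2, x.2))
      -!surjective_pairing mulrC.
    rewrite big1 ?addr0 // => j ji.
    rewrite linearZ /= -/(tensor_coord (x.1.1, x.1.2, j) T) -/(t (x.1.1, x.1.2, j)).
    rewrite (t_line x) ?scale0r //= ?eqxx ?add0n ?leq_b1 //.
    by apply: contraNneq ji => ->.
  by move/eqP; rewrite mulf_eq0 -[t x == 0]negbK -t_neq0 xS orbF => /eqP ->; rewrite scale0r.
Qed.

Lemma coord_sum_tnth (W : vectType F) (w : m.-tuple W) (x : 'I_m -> F) j :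
  basis_of fullv w -> coord w j (\sum_i x i *: tnth w i) = x j.
Proof.
move=> wP; rewrite linear_sum (bigD1 j) //= linearZ /= coord_tnth // eqxx mulr1.
by rewrite big1 ?addr0 // => i ij; rewrite linearZ /= coord_tnth // eq_sym (negPf ij) mulr0.
Qed.

Lemma basis_of_det (W : vectType F) (w : m.-tuple W) (M : 'M[F]_m) :
    basis_of fullv w -> \det M != 0 ->
  basis_of fullv [tuple \sum_j M i j *: tnth w j | i < m].
Proof.
move=> wP detM; rewrite basisEfree subvf size_tuple.
have -> : \dim {:W} = m by rewrite -(size_tuple w) -(eqP (basis_free wP)) (span_basis wP).
rewrite leqnn !andbT.
apply/freeP => k k0 i.
pose u : 'rV[F]_m := \row_i k i.
have uM : u *m M = 0.
  apply/rowP => j; rewrite !mxE -[RHS](linear0 (coord w j)) -k0 linear_sum.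
  apply: eq_bigr => l _; rewrite -tnth_nth tnth_mktuple linearZ /= coord_sum_tnth //.
  by rewrite mxE.
have : u = 0 by rewrite -[u](mulmxK (_ : M \in unitmx)) ?uM ?mul0mx // unitmxE unitfE.
by move/rowP/(_ i); rewrite !mxE.
Qed.

End TensorCoordinates.

(** * Parametrization of the tensors with given support *)

Section PolynomialMapsComplements.
Local Open Scope classical_set_scope.
Variables (F : numFieldType) (V : vectType F).

Lemma linear_form_peval (l : {scalar V}) :
  exists p : {mpoly F[\dim {:V}]}, forall v, peval p v = l v.
Proof.
exists (\sum_(i < \dim {:V}) l (vbasis {:V})`_i *: 'X_i) => v.
rewrite {2}(coord_vbasis (memvf v)) linear_sum /peval raddf_sum /=.
by apply: eq_bigr => i _; rewrite mevalZ mevalXU linearZ mulrC.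
Qed.

(** If [p] vanishes on [X], then [(p \mPo q) * D] vanishes everywhere, and [D] can be cancelled. *)
Lemma generic_range_sub d (phi : ('I_d -> F) -> V) (D : {mpoly F[d]}) (X : set V) :
    polynomial_map phi -> D != 0 -> (forall x, D.@[x] != 0 -> X (phi x)) ->
  range phi `<=` zariski_closure X.
Proof.
move=> [q qE] D_neq0 genX _ [x _ <-]; apply/zariski_closureP => p Xp.
have /eqP : (p \mPo q) * D = 0.
  apply: mpoly_eval_eq0 => y; rewrite mevalM -qE.
  by have [->|Dy] := eqVneq D.@[y] 0; rewrite ?mulr0 // Xp ?mul0r //; apply: genX.
by rewrite mulf_eq0 (negPf D_neq0) orbF qE => /eqP ->; rewrite meval0.
Qed.

Lemma irreducible_chain_sub (X Y : set V) n :
  X `<=` Y -> irreducible_chain X n -> irreducible_chain Y n.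
Proof.
move=> XY [Z [irrZ ltZ]]; exists Z; split=> // i le_in.
by have [irrZi ZX] := irrZ i le_in; split=> //; apply: subset_trans XY.
Qed.

End PolynomialMapsComplements.

Section Parametrization.
Local Notation slot := ('I_3 * 'I_3 * 'I_2)%type.
Local Notation point := ('I_3 * 'I_3 * 'I_3)%type.
Local Notation nvar n := (#|{: slot}| + n)%N.

Definition o0 : 'I_3 := @Ordinal 3 0 isT.
Definition o1 : 'I_3 := @Ordinal 3 1 isT.
Definition o2 : 'I_3 := @Ordinal 3 2 isT.

(** The variables are the 18 free entries of the three changes of basis, indexed by factor, row and
    free column, followed by [n] coefficients. As the coefficients come last, slices can fix the
    final ones. *)
Definition off n (s i : 'I_3) (k : 'I_2) : 'I_(nvar n) := lshift n (enum_rank (s, i, k)).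
Definition wt n (r : 'I_n) : 'I_(nvar n) := rshift #|{: slot}| r.

Section Coefficients.
Variables (n : nat) (K : comNzRingType) (f : 'I_3 -> 'I_3 -> 'I_3).
Variables (L : 'I_n -> point) (x : 'I_(nvar n) -> K).

(* Row i of the s-th change of basis has a 1 in column f s i; its two other
   entries are parameters. *)
Definition entry s i j : K := oapp (fun k => x (off n s i k)) 1 (unlift (f s i) j).

(** The ring [K] is general so that the same formula gives values in the field and polynomials in
    the parameters, related by evaluation as a ring morphism. *)
Definition coefficient (y : point) : K :=
  \sum_r x (wt r) * entry o0 (L r).1.1 y.1.1 * entry o1 (L r).1.2 y.1.2
         * entry o2 (L r).2 y.2.

End Coefficients.

Lemma rmorph_entry n (K K' : comNzRingType) (h : {rmorphism K -> K'}) f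
    (x : 'I_(nvar n) -> K) s i j :
  h (entry f x s i j) = entry f (h \o x) s i j.
Proof. by rewrite /entry; case: (unlift _ _) => [k|] //=; rewrite rmorph1. Qed.

Lemma rmorph_coefficient n (K K' : comNzRingType) (h : {rmorphism K -> K'}) f
    (L : 'I_n -> point) (x : 'I_(nvar n) -> K) y :
  h (coefficient f L x y) = coefficient f L (h \o x) y.
Proof.
by rewrite rmorph_sum; apply: eq_bigr => r _; rewrite !rmorphM !rmorph_entry.
Qed.

Variables (F : numFieldType) (A B C : vectType F).
Variables (a : 3.-tuple A) (b : 3.-tuple B) (c : 3.-tuple C).
Hypotheses (aP : basis_of fullv a) (bP : basis_of fullv b) (cP : basis_of fullv c).
Local Notation e := (basis_tensor a b c).
Local Notation tc := (tensor_coord a b c).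

Lemma tensor_coord_inj (T U : tensor_space A B C) : (forall y, tc y T = tc y U) -> T = U.
Proof.
move=> TU; rewrite (tensor_expand aP bP cP T) (tensor_expand aP bP cP U).
by apply: eq_bigr => y _; rewrite TU.
Qed.

Section Map.
Variables (n : nat) (f : 'I_3 -> 'I_3 -> 'I_3) (L : 'I_n -> point).

Definition param (x : 'I_(nvar n) -> F) : tensor_space A B C :=
  \sum_y coefficient f L x y *: e y.

Definition coefficient_poly y : {mpoly F[nvar n]} := coefficient f L (fun v => 'X_v) y.

Lemma meval_coefficient x y : (coefficient_poly y).@[x] = coefficient f L x y.
Proof.
rewrite rmorph_coefficient; congr (coefficient _ _ _ _).
by apply/funext => v /=; rewrite mevalXU.
Qed.

Lemma param_poly : polynomial_map param.
Proof.
have -> : param = fun x => \sum_y (coefficient_poly y).@[x] *: e y.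
  by apply/funext => x; apply: eq_bigr => y _; rewrite meval_coefficient.
exact: polynomial_map_sum.
Qed.

Lemma paramE x : param x = \sum_r x (wt r) *:
  (pure (\sum_j entry f x o0 (L r).1.1 j *: tnth a j)
       (\sum_j entry f x o1 (L r).1.2 j *: tnth b j)
       (\sum_j entry f x o2 (L r).2 j *: tnth c j) : tensor_space A B C).
Proof.
apply: tensor_coord_inj => y; rewrite tensor_coord_sum // linear_sum.
apply: eq_bigr => r _; rewrite linearZ /= tensor_coord_pure !coord_sum_tnth //.
by rewrite !mulrA.
Qed.

End Map.

(** Each vector of the adapted bases is divided by a nonzero coordinate, whose position is recorded
    in [fL.1]; the scalars go into the coefficients. The data [fL] range over a finite type, so
    finitely many maps cover all concise tight tensors. *)
Lemma tight_param (T : tensor F A B C) : concise_tight A B C 3 T ->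
  exists (fL : {ffun 'I_3 * 'I_3 -> 'I_3} * {ffun 'I_7 -> point}) x,
    T = param (fun s i => fL.1 (s, i)) fL.2 x.
Proof.
case=> _ [a' [b' [c' [S [[a'P b'P c'P] [supS tightS]]]]]].
have SE := (is_supportP a'P b'P c'P T S).1 supS.
have [size_S _] := oblique_set3 (tight_oblique_set tightS).
pose t y := tensor_coord a' b' c' y T.
pose N (s i j : 'I_3) : F := match (s : nat) with
  | 0 => coord a j (tnth a' i) | 1 => coord b j (tnth b' i) | _ => coord c j (tnth c' i)
  end.
have basis_neq0 (W : vectType F) (w w' : 3.-tuple W) i : basis_of fullv w ->
    basis_of fullv w' -> exists j, coord w j (tnth w' i) != 0.
  move=> wP w'P; apply/existsP; apply: contraT; rewrite negb_exists => /forallP w0.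
  have := coord_tnth i i w'P; rewrite (coord_expand (tnth w' i) wP) big1.
    by rewrite linear0 eqxx => /esym/eqP; rewrite oner_eq0.
  by move=> j _; have := w0 j; rewrite negbK => /eqP ->; rewrite scale0r.
have /choice[f f_neq0] : forall p : 'I_3 * 'I_3, exists j, N p.1 p.2 j != 0.
  by case=> [[[|[|s]] lt_s] i]; rewrite /N /=; apply: basis_neq0.
pose al s i := N s i (f (s, i)).
(* The support is padded to seven points by [z0], with coefficient 0 in [x]. *)
pose z0 : point := (ord0, ord0, ord0).
pose l r := nth z0 (enum S) r.
pose wgt (y : point) := t y * al o0 y.1.1 * al o1 y.1.2 * al o2 y.2.
pose x (v : 'I_(nvar 7)) : F := match split v with
  | inl j => let: (s, i, k) := enum_val j in N s i (lift (f (s, i)) k) / al s i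
  | inr r => if (r < #|S|)%N then wgt (l r) else 0
  end.
exists ([ffun p => f p], [ffun r : 'I_7 => l r]), x.
set f' := fun s i => _.
have entryE s i j : entry f' x s i j = N s i j / al s i.
  rewrite /entry /f' ffunE; case: unliftP => [k|] -> /=.
    by rewrite /x /off -/(unsplit (inl _)) unsplitK enum_rankK.
  by rewrite divff // f_neq0.
apply: tensor_coord_inj => y; rewrite [in RHS]tensor_coord_sum //.
rewrite (tensor_expand a'P b'P c'P T) linear_sum.
pose G z := t z * (N o0 z.1.1 y.1.1 * N o1 z.1.2 y.1.2 * N o2 z.2 y.2).
transitivity (\sum_(z in S) G z).
  rewrite (bigID (mem S)) /= [X in _ + X]big1 ?addr0 => [|z].
    by apply: eq_bigr => z _; rewrite linearZ /= tensor_coord_pure.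
  by rewrite SE inE negbK => /eqP ->; rewrite scale0r linear0.
rewrite big_enum_val /=; transitivity (\sum_(r < #|S|) G (l r)).
  by apply: eq_bigr => r _; rewrite (enum_val_nth z0).
rewrite (big_ord_widen _ (fun r => G (l r)) size_S) big_mkcond; apply: eq_bigr => r _.
rewrite !entryE /wt /x -/(unsplit (inr _)) unsplitK ffunE.
case: ifP => _; last by rewrite !mul0r.
rewrite /G /wgt; set y' := l r.
have a0 := f_neq0 (o0, y'.1.1); have a1 := f_neq0 (o1, y'.1.2); have a2 := f_neq0 (o2, y'.2).
rewrite -/(al _ _) in a0 a1 a2.
move: a0 a1 a2; rewrite /= -![N _ _ (f _)]/(al _ _).
move: (al o0 _) (al o1 _) (al o2 _) => u v w u0 v0 w0.
by rewrite mulrACA; field; rewrite u0 v0 w0.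
Qed.

End Parametrization.

(** * The unit tensor and the differential of the parametrization there *)

Section UnitTensor.
Local Notation slot := ('I_3 * 'I_3 * 'I_2)%type.
Local Notation point := ('I_3 * 'I_3 * 'I_3)%type.
Local Notation nvar n := (#|{: slot}| + n)%N.

(* A free support; its first seven points form a tight one. *)
Definition points9 : seq point :=
  [:: (o0, o0, o0); (o1, o1, o1); (o2, o2, o2);
      (o0, o1, o2); (o1, o2, o0); (o2, o0, o1); (o1, o0, o2);
      (o0, o2, o1); (o2, o1, o0)].

(** Indexing by [3 + 6] lets [split] separate the diagonal points from the permutations. *)
Definition free_pt (r : 'I_(3 + 6)) : point := nth (o0, o0, o0) points9 r.

Lemma free_pt_diag (i : 'I_3) : free_pt (lshift 6 i) = (i, i, i).
Proof.
by case: i => [[|[|[|//]]] lt_i]; rewrite /free_pt /=; congr (_, _, _);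
  apply: val_inj.
Qed.

Lemma free_pt_free (r r' : 'I_(3 + 6)) : r != r' ->
  (2 <= ((free_pt r).1.1 != (free_pt r').1.1) +
        ((free_pt r).1.2 != (free_pt r').1.2) + ((free_pt r).2 != (free_pt r').2))%N.
Proof.
rewrite /free_pt -(inj_eq val_inj) /=.
have /allP/(_ r) : all (fun p => all (fun q => (p == q) || (2 <=
    ((nth (o0, o0, o0) points9 p).1.1 != (nth (o0, o0, o0) points9 q).1.1) +
    ((nth (o0, o0, o0) points9 p).1.2 != (nth (o0, o0, o0) points9 q).1.2) +
    ((nth (o0, o0, o0) points9 p).2 != (nth (o0, o0, o0) points9 q).2))%N)
  (iota 0 9)) (iota 0 9) by vm_compute.
rewrite mem_iota ltn_ord => /(_ isT)/allP/(_ r'); rewrite mem_iota ltn_ord => /(_ isT).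
by case/orP => [->|].
Qed.

Lemma free_pt_inj : injective free_pt.
Proof.
move=> r r' eq_rr; apply/eqP; apply: contraT => /free_pt_free.
by rewrite eq_rr !eqxx.
Qed.

(** The diagonal points force [tauC i = - (tauA i + tauB i)]; with these values the sum also
    vanishes on the first four permutations of [points9], but not on the last two. *)
Definition tauA (i : 'I_3) : int := nth 0 [:: 0; 1; 2] i.
Definition tauB (i : 'I_3) : int := nth 0 [:: 1; 2; 0] i.
Definition tauC (i : 'I_3) : int := nth 0 [:: -1; -3; -2] i.

Lemma tau_inj : [/\ injective tauA, injective tauB & injective tauC].
Proof.
by split=> [] [[|[|[|//]]] lt_i] [[|[|[|//]]] lt_j] // _; apply: val_inj.
Qed.

Lemma free_pt_tight (r : 'I_(3 + 6)) : (r < 7)%N ->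
  tauA (free_pt r).1.1 + tauB (free_pt r).1.2 + tauC (free_pt r).2 = 0.
Proof. by case: r => [[|[|[|[|[|[|[|//]]]]]]] ?]. Qed.

(* The coordinate of the tensor to which the v-th parameter contributes at first
   order near the unit tensor. *)
Definition target (v : 'I_(nvar (3 + 6))) : point :=
  match split v with
  | inl j => let: (s, i, k) := enum_val j in
      match (s : nat) with
      | 0 => (lift i k, i, i) | 1 => (i, lift i k, i) | _ => (i, i, lift i k)
      end
  | inr r => free_pt r
  end.

Lemma target_off (s i : 'I_3) k : target (off (3 + 6) s i k) =
  match (s : nat) with
  | 0 => (lift i k, i, i) | 1 => (i, lift i k, i) | _ => (i, i, lift i k)
  end.
Proof. by rewrite /target /off -/(unsplit (inl _)) unsplitK enum_rankK. Qed.

Lemma target_wt r : target (wt r) = free_pt r.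
Proof. by rewrite /target /wt -/(unsplit (inr _)) unsplitK. Qed.

(** Points with exactly two equal entries come from the changes of basis, the others from the
    coefficients. Surjectivity suffices, since both sides have 27 elements. *)
Lemma target_bij : bijective target.
Proof.
have surj y : exists v, target v == y.
  case: y => [[i j] k]; have [ij|ij] := eqVneq i j.
    have [jk|] := eqVneq k j.
      by exists (wt (lshift 6 i)); rewrite target_wt free_pt_diag ij jk.
    rewrite eq_sym => /unlift_some[q kq _].
    by exists (off (3 + 6) o2 j q); rewrite target_off /= ij kq.
  have [jk|jk] := eqVneq j k.
    move: ij; rewrite eq_sym => /unlift_some[q iq _].
    by exists (off (3 + 6) o0 j q); rewrite target_off /= -jk iq.
  have [ik|ik] := eqVneq i k.
    move: ij => /unlift_some[q jq _].
    by exists (off (3 + 6) o1 i q); rewrite target_off /= -ik jq.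
  have /(nthP (o0, o0, o0))[r lt_r rE] : (i, j, k) \in points9.
    move: i j k ij jk ik.
    by move=> [[|[|[|//]]] ?] [[|[|[|//]]] ?] [[|[|[|//]]] ?].
  by exists (wt (Ordinal (lt_r : (r < 3 + 6)%N))); rewrite target_wt /free_pt rE.
have [g gK] := choice surj.
have {}gK : cancel g target by move=> y; apply/eqP.
have g_bij : bijective g.
  apply: inj_card_bij (can_inj gK) _.
  by rewrite !card_prod !card_ord.
by have := bij_can_bij g_bij gK; apply.
Qed.

Section Jacobian.
Variable F : numFieldType.

(** The parameters of the unit tensor: identity changes of basis, coefficient 1 on the diagonal
    points and 0 on the permutations. *)
Definition base_point (v : 'I_(nvar (3 + 6))) : F :=
  match split v with
  | inl _ => 0
  | inr r => if split r is inl _ then 1 else 0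
  end.

Lemma base_point_off s i k : base_point (off (3 + 6) s i k) = 0.
Proof. by rewrite /base_point /off -/(unsplit (inl _)) unsplitK. Qed.

Lemma base_point_wt r : base_point (wt r) = if split r is inl _ then 1 else 0.
Proof. by rewrite /base_point /wt -/(unsplit (inr _)) unsplitK. Qed.

Local Notation standard := (fun _ i : 'I_3 => i).

Lemma entry_base s i j : entry standard base_point s i j = (i == j)%:R.
Proof.
rewrite /entry; case: unliftP => [k|] -> /=; last by rewrite eqxx.
by rewrite base_point_off (negPf (neq_lift _ _)).
Qed.

Local Notation X := (fun v => 'X_v : {mpoly F[nvar (3 + 6)]}).

Lemma meval_entry s i j : (entry standard X s i j).@[base_point] = (i == j)%:R.
Proof.
rewrite rmorph_entry -(entry_base s); congr (entry _ _ _ _).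
by apply/funext => v /=; rewrite mevalXU.
Qed.

Lemma mderiv_entry_wt r s i j : mderiv (wt r) (entry standard X s i j) = 0.
Proof.
rewrite /entry; case: unlift => [k|] /=; last by rewrite -mpolyC1 mderivC.
by rewrite mderivXU /off /wt eq_lrshift.
Qed.

Lemma mderiv_entry_off s' i' k s i j : mderiv (off (3 + 6) s' i' k) (entry standard X s i j) =
  [&& s == s', i == i' & j == lift i' k]%:R.
Proof.
rewrite /entry; case: unliftP => [k'|] -> /=.
  rewrite mderivXU /off eq_lshift (inj_eq enum_rank_inj) !xpair_eqE -andbA.
  by case: eqP => // _; case: eqP => //= ->; rewrite (inj_eq lift_inj).
rewrite -mpolyC1 mderivC; case: (s == s') => //=.
by case: eqP => //= ->; rewrite (negPf (neq_lift _ _)).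
Qed.

(** By the Leibniz rule a coefficient variable contributes its own point. A variable in row [i] of a
    change of basis acts only through the diagonal term [(i, i, i)], as the other terms involving
    that row have coefficient 0. *)
Lemma jacobian_unit_tensor y v :
  (mderiv v (coefficient_poly F standard free_pt y)).@[base_point] = (y == target v)%:R.
Proof.
rewrite /coefficient_poly /coefficient (raddf_sum (mderiv v)) (raddf_sum (meval base_point)) /=.
pose D s i j := (mderiv v (entry standard X s i j)).@[base_point].
pose w r := (mderiv v ('X_(wt r) : {mpoly F[nvar (3 + 6)]})).@[base_point].
transitivity (\sum_(r < 3 + 6)
    (w r * ((free_pt r).1.1 == y.1.1)%:R * ((free_pt r).1.2 == y.1.2)%:R *
       ((free_pt r).2 == y.2)%:R +
     base_point (wt r) *
      (D o0 (free_pt r).1.1 y.1.1 * ((free_pt r).1.2 == y.1.2)%:R *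
       ((free_pt r).2 == y.2)%:R +
       ((free_pt r).1.1 == y.1.1)%:R * D o1 (free_pt r).1.2 y.1.2 *
       ((free_pt r).2 == y.2)%:R +
       ((free_pt r).1.1 == y.1.1)%:R * ((free_pt r).1.2 == y.1.2)%:R *
       D o2 (free_pt r).2 y.2))).
  apply: eq_bigr => r _; rewrite !mderivM !(mevalD, mevalM) !meval_entry mevalXU -/(w r).
  by rewrite -!/(D _ _ _); ring.
have indicator (p : point) : ((p.1.1 == y.1.1)%:R * (p.1.2 == y.1.2)%:R * (p.2 == y.2)%:R : F) =
    (y == p)%:R.
  by rewrite [y == p]eq_sym -!natrM !mulnb; case: p y => [[? ?] ?] [[? ?] ?].
case: (splitP v) => [j vj|r' vr'].
  have [[[s i] k] vE] : exists sik, v = off (3 + 6) sik.1.1 sik.1.2 sik.2.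
    exists (enum_val j); apply: val_inj; rewrite /= vj.
    by rewrite -!surjective_pairing enum_valK.
  have w0 r : w r = 0 by rewrite /w vE mderivXU /off /wt eq_rlshift mevalC.
  have DE s' i' j' : D s' i' j' = [&& s' == s, i' == i & j' == lift i k]%:R.
    by rewrite /D vE mderiv_entry_off rmorph_nat.
  rewrite big_split_ord /= [X in _ + X]big1 ?addr0 => [|q _]; last first.
    by rewrite w0 base_point_wt -/(unsplit (inr _)) unsplitK !mul0r addr0.
  rewrite (bigD1 i) //= big1 ?addr0 => [|q qi]; last first.
    rewrite w0 base_point_wt -/(unsplit (inl _)) unsplitK free_pt_diag !DE (negPf qi) /=.
    by rewrite !andbF !(mul0r, mulr0, addr0).
  rewrite w0 base_point_wt -/(unsplit (inl _)) unsplitK free_pt_diag !DE eqxx /= !mul0r add0r mul1r.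
  rewrite vE target_off /= -indicator.
  by case: s {vE DE} => [[|[|[|//]]] lt_s] /=; rewrite !(mul0r, mulr0, addr0, add0r) //;
    rewrite [_ == lift i k]eq_sym.
have vE : v = wt r' by apply: val_inj.
have D0 s i j : D s i j = 0 by rewrite /D vE mderiv_entry_wt meval0.
have wE r : w r = (r == r')%:R by rewrite /w vE mderivXU /wt eq_rshift rmorph_nat.
rewrite (bigD1 r') //= big1 => [|r rr'].
  by rewrite addr0 !D0 !(mul0r, mulr0, addr0) wE eqxx mul1r indicator vE target_wt.
by rewrite wE (negPf rr') !D0 !(mul0r, mulr0, addr0).
Qed.

End Jacobian.
End UnitTensor.

(** * Density of the free tensors and dimension of the tight closure *)

Section Closures.
Local Open Scope classical_set_scope.
Local Notation slot := ('I_3 * 'I_3 * 'I_2)%type.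
Local Notation point := ('I_3 * 'I_3 * 'I_3)%type.
Local Notation nvar n := (#|{: slot}| + n)%N.
Local Notation standard := (fun _ i : 'I_3 => i).
Variables (F : numFieldType) (A B C : vectType F).
Variables (a : 3.-tuple A) (b : 3.-tuple B) (c : 3.-tuple C).
Hypotheses (aP : basis_of fullv a) (bP : basis_of fullv b) (cP : basis_of fullv c).
Local Notation e := (basis_tensor a b c).
Local Notation tc := (tensor_coord a b c).
Local Notation phi := (param a b c standard free_pt).
Local Notation x0 := (base_point F).

(** Where it is nonzero, the three new families are bases and the support contains the diagonal,
    hence is concise. *)
Definition nondegenerate : {mpoly F[nvar (3 + 6)]} :=
  \prod_(s < 3) \det (\matrix_(i, j) entry standard (fun v => 'X_v) s i j) *
  \prod_(i < 3) 'X_(wt (lshift 6 i)).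

Lemma meval_nondegenerate x : nondegenerate.@[x] =
  \prod_(s < 3) \det (\matrix_(i, j) entry standard x s i j) *
  \prod_(i < 3) x (wt (lshift 6 i)).
Proof.
rewrite mevalM !rmorph_prod /=; congr (_ * _); apply: eq_bigr => s _; last exact: mevalXU.
rewrite -det_map_mx; congr (\det _); apply/matrixP => i j; rewrite !mxE rmorph_entry.
by congr (entry _ _ _ _); apply/funext => v /=; rewrite mevalXU.
Qed.

Lemma nondegenerate_base : nondegenerate.@[x0] = 1.
Proof.
rewrite meval_nondegenerate !big1 ?mulr1 // => s _.
  by rewrite base_point_wt -/(unsplit (inl _)) unsplitK.
have -> : \matrix_(i, j) entry standard x0 s i j = 1%:M.
  by apply/matrixP => i j; rewrite !mxE entry_base.
exact: det1.
Qed.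

Lemma param_support x : nondegenerate.@[x] != 0 ->
  exists (a' : 3.-tuple A) (b' : 3.-tuple B) (c' : 3.-tuple C) S,
    [/\ [/\ basis_of fullv a', basis_of fullv b' & basis_of fullv c'],
        is_support a' b' c' (phi x) S, concise_set S
      & forall y, y \in S -> exists2 r, x (wt r) != 0 & y = free_pt r].
Proof.
rewrite meval_nondegenerate mulf_eq0 negb_or => /andP[/prodf_neq0 det_neq0 /prodf_neq0 x_neq0].
pose M s : 'M[F]_3 := \matrix_(i, j) entry standard x s i j.
pose t y := \sum_r x (wt r) * (free_pt r == y)%:R.
have tL r : t (free_pt r) = x (wt r).
  rewrite /t (bigD1 r) //= eqxx mulr1 big1 ?addr0 // => q qr.
  by rewrite (inj_eq free_pt_inj) (negPf qr) mulr0.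
exists [tuple \sum_j M o0 i j *: tnth a j | i < 3],
  [tuple \sum_j M o1 i j *: tnth b j | i < 3], [tuple \sum_j M o2 i j *: tnth c j | i < 3],
  (finset (fun y => t y != 0)).
have diag_S i : (i, i, i) \in finset (fun y => t y != 0).
  by rewrite inE -free_pt_diag tL x_neq0.
have bas0 := basis_of_det aP (det_neq0 o0 isT).
have bas1 := basis_of_det bP (det_neq0 o1 isT).
have bas2 := basis_of_det cP (det_neq0 o2 isT).
split=> //.
- apply/is_supportP; [exact: bas0 | exact: bas1 | exact: bas2|].
  apply/setP => y; rewrite !inE; congr (_ != 0).
  rewrite (paramE aP bP cP) /t linear_sum; apply: eq_bigr => r _; rewrite linearZ eq_sym.
  rewrite -(tensor_coord_basis bas0 bas1 bas2) /basis_tensor !tnth_mktuple.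
  congr (_ * tensor_coord _ _ _ _ (pure _ _ _));
    by apply: eq_bigr => j _; rewrite mxE.
- by split=> i; exists (i, i, i).
move=> y; rewrite inE => ty; have [r rP] : exists r, x (wt r) * (free_pt r == y)%:R != 0.
    apply/existsP; apply: contraT; rewrite negb_exists => /forallP t0.
    by move: ty; rewrite /t big1 ?eqxx // => r _; apply/eqP/negPn/t0.
  exists r; first by apply: contraNneq rP => ->; rewrite mul0r.
  by move: rP; case: (free_pt r =P y) => [->|_] //; rewrite mulr0 eqxx.
Qed.

Lemma param_concise x (P : {set point} -> Prop) : nondegenerate.@[x] != 0 ->
    (forall S, concise_set S ->
       (forall y, y \in S -> exists2 r, x (wt r) != 0 & y = free_pt r) -> P S) ->
  concise_tensor (phi x) /\ has_support_in_some_bases P (phi x).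
Proof.
move=> /param_support[a' [b' [c' [S [[a'P b'P c'P] supS conS SL]]]]] PS.
have freeS : free_set S.
  split=> // y y' /SL[r _ ->] /SL[r' _ ->] rr'; apply: free_pt_free.
  by apply: contraNneq rr' => ->.
split; first exact: concise_free_support supS freeS.
by exists a', b', c', S; split=> //; split=> //; apply: PS.
Qed.

Lemma param_free x : nondegenerate.@[x] != 0 -> concise_free A B C 3 (phi x).
Proof.
move=> Dx; apply: (param_concise Dx) => S conS SL; split=> //.
move=> y y' /SL[r _ ->] /SL[r' _ ->] rr'; apply: free_pt_free.
by apply: contraNneq rr' => ->.
Qed.

Lemma slice_wt (y : 'I_(nvar 7) -> F) (r : 'I_(3 + 6)) :
  slice x0 y (wt r) != 0 -> (r < 7)%N.
Proof.
apply: contraNT; rewrite -leqNgt => le7r.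
rewrite /slice insubN /= -?leqNgt ?leq_add2l // base_point_wt.
by case: splitP => // i ri; move: le7r; rewrite ri leqNgt (leq_trans (ltn_ord i)).
Qed.

Lemma param_tight (y : 'I_(nvar 7) -> F) :
  nondegenerate.@[slice x0 y] != 0 -> concise_tight A B C 3 (phi (slice x0 y)).
Proof.
move=> Dx; apply: (param_concise Dx) => S conS SL; split=> //.
exists tauA, tauB, tauC; have [tA tB tC] := tau_inj; split=> // z.
by case/SL => r /slice_wt lt_r7 ->; apply: free_pt_tight.
Qed.

(** Reindexing along [target] identifies affine 27-space with the tensor space. *)
Let lin (z : 'I_(nvar (3 + 6)) -> F) : tensor_space A B C := \sum_v z v *: e (target v).

Lemma lin_coord T : lin (fun v => tc (target v) T) = T.
Proof.
rewrite [RHS](tensor_expand aP bP cP).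
by rewrite [RHS](reindex _ (onW_bij _ target_bij)).
Qed.

Lemma lin_poly : polynomial_map lin.
Proof.
have -> : lin = fun z => \sum_v ('X_v : {mpoly F[nvar (3 + 6)]}).@[z] *: e (target v).
  by apply/funext => z; apply: eq_bigr => v _; rewrite mevalXU.
exact: polynomial_map_sum.
Qed.

Let psi := [tuple coefficient_poly F standard free_pt (target v) | v < nvar (3 + 6)].

Lemma coordinate_forms : exists lam : 'I_(nvar (3 + 6)) -> {mpoly F[\dim {: tensor_space A B C}]},
  forall v T, peval (lam v) T = tc (target v) T.
Proof.
have [lam lamE] := choice (fun v => linear_form_peval (tensor_coord a b c (target v))).
by exists lam.
Qed.

Lemma param_coordE x v : tc (target v) (phi x) = (tnth psi v).@[x].
Proof. by rewrite tensor_coord_sum // tnth_mktuple meval_coefficient. Qed.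

Lemma param_jacobian i j : (mderiv j (tnth psi i)).@[x0] = (i == j)%:R.
Proof. by rewrite tnth_mktuple jacobian_unit_tensor (inj_eq (bij_inj target_bij)). Qed.

(** A polynomial function vanishing on the image is a relation between the coordinate forms [lam],
    which are independent there; the slice used is the whole space. *)
Lemma range_param_dense (T : tensor_space A B C) : zariski_closure (range phi) T.
Proof.
apply/zariski_closureP => p p0.
have [lam lamE] := coordinate_forms; have [q qE] := lin_poly.
have psiE x v : peval (lam v) (phi x) = (tnth psi v).@[x] by rewrite lamE param_coordE.
have indep := slice_independent (le_kd := leqnn _) psiE param_jacobian.
have pq0 : p \mPo q = 0.
  apply: indep => _ [y _ <-]; set T' := phi _.
  rewrite -qE -[RHS](p0 T'); last by exists (slice x0 y).
  congr (peval p _); rewrite -[RHS]lin_coord; congr (lin _); apply/funext => v.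
  by rewrite lamE; congr (tc (target _) _); apply: val_inj.
by rewrite -[T]lin_coord qE pq0 meval0.
Qed.

Lemma free_dense : [set: tensor F A B C] = zariski_closure (concise_free A B C 3).
Proof.
apply/seteqP; split=> // T _.
have D_neq0 : nondegenerate != 0.
  by apply: contraTneq (oner_neq0 F) => D0; rewrite -nondegenerate_base D0 meval0 eqxx.
have sub := generic_range_sub (param_poly a b c standard free_pt) D_neq0 param_free.
exact: zariski_closure_min sub T (range_param_dense T).
Qed.

Lemma param_chain n (le_n : (n <= nvar (3 + 6))%N) :
  irreducible_chain (zariski_closure (range (fun y : 'I_n -> F => phi (slice x0 y)))) n.
Proof.
have [lam lamE] := coordinate_forms.
apply: (jacobian_chain (lam := lam) (psi := psi)) => //.
- exact: param_poly.
- by move=> x v; rewrite lamE param_coordE.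
- exact: param_jacobian.
Qed.

Lemma card_slot : #|{: slot}| = 18.
Proof. by rewrite !card_prod !card_ord. Qed.

Lemma tensor_dimension : has_dimension [set: tensor F A B C] 27.
Proof.
have -> : 27%N = nvar (3 + 6) by rewrite card_slot.
split=> [|n].
  by apply: irreducible_chain_sub (param_chain (leqnn _)).
apply: (irreducible_chain_le (L := unit) (phi := fun=> lin)) => [_|T _]; first exact: lin_poly.
by apply: sub_zariski_closure; exists tt, (fun v => tc (target v) T); rewrite lin_coord.
Qed.

Lemma tight_dimension : has_dimension (zariski_closure (concise_tight A B C 3)) 25.
Proof.
have -> : 25%N = nvar 7 by rewrite card_slot.
split=> [|n].
  have le_n : (nvar 7 <= nvar (3 + 6))%N by rewrite leq_add2l.
  apply: irreducible_chain_sub (param_chain le_n); apply: zariski_closure_min.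
  (* The restriction of [nondegenerate] to the slice is nonzero because the slice contains the base
     point, where the value is 1. *)
  pose D := nondegenerate \mPo slice_poly x0 (nvar 7).
  have DE y : D.@[y] = nondegenerate.@[slice x0 y] by rewrite comp_mpoly_meval -slice_polyE.
  apply: (generic_range_sub (D := D)).
  - exact/slice_map_poly/param_poly.
  - apply: contraTneq (oner_neq0 F) => D0; rewrite -nondegenerate_base.
    by rewrite -[x0 in _.@[x0]](slice_base _ le_n) -DE D0 meval0 eqxx.
  - by move=> y; rewrite DE; apply: param_tight.
apply: (irreducible_chain_le
  (L := ({ffun 'I_3 * 'I_3 -> 'I_3} * {ffun 'I_7 -> point})%type)
  (phi := fun fL => param a b c (fun s i => fL.1 (s, i)) fL.2)) => [fL|].
  exact: param_poly.
apply: zariski_closure_min => T /(tight_param aP bP cP)[fL [x TE]].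
by apply: sub_zariski_closure; exists fL, x.
Qed.

End Closures.

Local Open Scope classical_set_scope.

Lemma concise_tight_oblique (F : numFieldType) (A B C : vectType F) :
  concise_tight A B C 3 = concise_oblique A B C 3.
Proof.
apply/seteqP; split=> T [conT [a [b [c [S [bases [supS PS]]]]]]]; split=> //;
  exists a, b, c, S; do 2!split=> //.
- exact: tight_oblique_set.
- exact: (oblique_set3 PS).2.
Qed.

Lemma basis_tuple (F : fieldType) (W : vectType F) n : \dim {:W} = n ->
  exists w : n.-tuple W, basis_of fullv w.
Proof. by move=> <-; exists (vbasis {:W}); apply: vbasisP. Qed.

Lemma closures_of_concise_tensors (F : numFieldType) (A B C : vectType F) :
    \dim {:A} = 3%N -> \dim {:B} = 3%N -> \dim {:C} = 3%N ->
  [/\ [set: tensor F A B C] = zariski_closure (concise_free A B C 3),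
      zariski_closure (concise_tight A B C 3) =
        zariski_closure (concise_oblique A B C 3)
    & has_codimension (zariski_closure (concise_tight A B C 3)) 2].
Proof.
move=> /basis_tuple[a aP] /basis_tuple[b bP] /basis_tuple[c cP]; split.
- exact: (free_dense aP bP cP).
- by rewrite (concise_tight_oblique A B C).
- exists 25%N; split; first exact: (tight_dimension aP bP cP).
  exact: (tensor_dimension aP bP cP).
Qed.

Theorem theorem1p9 (R : realType) (A B C : vectType R[i])
    (dimA : \dim {:A} = 3%N) (dimB : \dim {:B} = 3%N)
    (dimC : \dim {:C} = 3%N) :
  [/\ [set: tensor R[i] A B C] = zariski_closure (concise_free A B C 3),
      zariski_closure (concise_tight A B C 3) =
        zariski_closure (concise_oblique A B C 3)
    & has_codimension (zariski_closure (concise_tight A B C 3)) 2].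
Proof. exact: closures_of_concise_tensors. Qed.
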